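(* Let $\sigma\in S_n$ be smooth. Then $G$ acts transitively on $\mathcal D^{\mathrm{gen}}$, which is therefore the open $G$-orbit in $\mathcal D$. In particular, $S^\sigma_\lambda$ is surjective for every $\lambda\in\mathcal D^{\mathrm{gen}}$, and $\sigma$ is rigid.
   Context: A permutation is smooth if it avoids the patterns $3412$ and $4231$. Let $\Bbbk$ be an algebraically closed field of arbitrary characteristic. For $\sigma\in S_n$ (one-line notation $\sigma_1\cdots\sigma_n$) let $X_\sigma=\{(i,k):i<k,\ \sigma_i>\sigma_k\}$ and $Y_\sigma=X_\sigma\sqcup\{(c,c):1\le c\le n\}$. Let $\mathcal A$ be the $\Bbbk$-algebra with basis $\alpha_{ij}$, $(i,j)\in Y_\sigma$, unit $\sum_i\alpha_{ii}$, and multiplication $\alpha_{ij}\alpha_{lm}=\delta_{jl}\alpha_{im}$; let $\mathcal D$ be the $\mathcal A$-bimodule with basis $\beta_{ij}$, $(i,j)\in X_\sigma$, and $\alpha_{ij}\beta_{lm}=\delta_{jl}\beta_{im}$, $\beta_{ij}\alpha_{lm}=\delta_{jl}\beta_{im}$. The group $G=\mathcal A^\times$ acts on $\mathcal D$ by $g\cdot\lambda=g\lambda g^{-1}$. For $\lambda\in\mathcal D$ put $S^\sigma_\lambda:\mathcal A\to\mathcal D$, $S^\sigma_\lambda(a)=a\lambda-\lambda a$. $\mathcal D^{\mathrm{gen}}=\{\lambda\in\mathcal D:\mathcal A\lambda\mathcal A=\mathcal D\}$ is the set of generators of $\mathcal D$. Explicitly, writing $\lambda=\sum\lambda_{ij}\beta_{ij}$,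 it is $\{\lambda:\lambda_{ik}\neq0\text{ for all }(i,k)\in\mathrm{Cov}(\sigma)\}$, where $\mathrm{Cov}(\sigma)$ is the set of minimal inversions, i.e. $(i,k)\in X_\sigma$ for which there is no $j$ with $i<j<k$ and $\sigma_i>\sigma_j>\sigma_k$. Rigidity of $\sigma$: let $Q$ be the quiver $1\to2\to\cdots\to 2n-1$ with preprojective algebra $\Pi$, $M([a,b])$ the representation of $Q$ with a one-dimensional space at each vertex of $[a,b]$, zero elsewhere, and nonzero maps along all arrows inside $[a,b]$, and $M=\bigoplus_{i=1}^nM([i,2n-\sigma_i])$ with underlying graded space $V$. Let $\Lambda(V)$ be the variety of $\Pi$-module structures on $V$, i.e. pairs $(T,B)$, $T_v:V_v\to V_{v+1}$, $B_v:V_{v+1}\to V_v$, with $T_{v-1}B_{v-1}=B_vT_v$ for all $1\le v\le 2n-1$ (maps involving $V_0=V_{2n}=0$ being zero), and $C_\sigma$ the closure of $\{(T,B)\in\Lambda(V):T\cong M\}$, an irreducible component of $\Lambda(V)$. Then $\sigma$ is rigid if there is $x\in C_\sigma$ with $\mathrm{Ext}^1_\Pi(x,x)=0$. (Here $\mathcal A\cong\mathrm{End}_Q(M)$ and $\mathcal D\cong\mathrm{Ext}^1_Q(M,M)^*$.) *)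

(* Defs.v *)
From HB Require Import structures.
From mathcomp Require Import all_boot all_order all_fingroup all_algebra.
From mathcomp Require Import mpoly.

Set Implicit Arguments.
Unset Strict Implicit.
Unset Printing Implicit Defensive.

Import GRing.Theory.

Local Open Scope ring_scope.

(* Permutations are 0-based: [s : 'S_n] sends the position [i : 'I_n] to the
   value [s i : 'I_n]; the one-line entry sigma_(i+1) is [(s i).+1]. *)

Section Permutations.
Variables (n : nat) (s : 'S_n).

(* A pattern is given by its one-line notation. *)
Definition contains_pattern (p : seq nat) : Prop :=
  exists f : 'I_(size p) -> 'I_n,
    (forall a b : 'I_(size p), (a < b)%N -> (f a < f b)%N) /\
    (forall a b : 'I_(size p),
        (s (f a) < s (f b))%N = (nth 0%N p a < nth 0%N p b)%N).

Definition smooth : Prop :=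
  ~ contains_pattern [:: 3; 4; 1; 2]%N /\ ~ contains_pattern [:: 4; 2; 3; 1]%N.

Definition inX (i k : 'I_n) : bool := (i < k)%N && (s k < s i)%N.
Definition inY (i k : 'I_n) : bool := inX i k || (i == k).

Lemma inX_neq i k : inX i k -> i != k.
Proof. by case/andP => lt_ik _; rewrite neq_ltn lt_ik. Qed.

Lemma inX_trans i j k : inX i j -> inX j k -> inX i k.
Proof.
case/andP => ij sij /andP[jk sjk]; apply/andP; split.
  exact: ltn_trans ij jk.
exact: ltn_trans sjk sij.
Qed.

Lemma inXY i j : inX i j -> inY i j.
Proof. by rewrite /inY => ->. Qed.

Lemma inXY_trans i j k : inX i j -> inY j k -> inX i k.
Proof. by move=> ij /orP[/(inX_trans ij)|/eqP <-]. Qed.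

Lemma inYX_trans i j k : inY i j -> inX j k -> inX i k.
Proof. by case/orP=> [ij /(inX_trans ij)|/eqP ->]. Qed.

Lemma inY_trans i j k : inY i j -> inY j k -> inY i k.
Proof.
by move=> ij /orP[jk|/eqP <- //]; apply: inXY; apply: inYX_trans ij jk.
Qed.

End Permutations.

(* The algebra A and the bimodule D, realised by matrices: alpha_ij is the
   matrix unit E_ij for (i,j) in Y, and beta_ij the matrix unit E_ij for
   (i,j) in X.  The lemmas alpha*, beta* below recover the presentation by
   bases and structure constants. *)

Section AlgebraA.
Variables (k : fieldType) (n : nat) (s : 'S_n).

Definition suppY : {pred 'M[k]_n} :=
  fun a => [forall i, forall j, ~~ inY s i j ==> (a i j == 0)].
Definition suppX : {pred 'M[k]_n} :=
  fun a => [forall i, forall j, ~~ inX s i j ==> (a i j == 0)].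

Lemma suppYP (a : 'M[k]_n) :
  reflect (forall i j, ~~ inY s i j -> a i j = 0) (a \in suppY).
Proof.
apply: (iffP forallP) => [h i j nY|h i].
  by have /forallP/(_ j)/implyP/(_ nY)/eqP := h i.
by apply/forallP => j; apply/implyP => nY; rewrite h.
Qed.

Lemma suppXP (a : 'M[k]_n) :
  reflect (forall i j, ~~ inX s i j -> a i j = 0) (a \in suppX).
Proof.
apply: (iffP forallP) => [h i j nX|h i].
  by have /forallP/(_ j)/implyP/(_ nX)/eqP := h i.
by apply/forallP => j; apply/implyP => nX; rewrite h.
Qed.

Lemma suppY_subring : subring_closed suppY.
Proof.
split=> [|a b /suppYP ha /suppYP hb|a b /suppYP ha /suppYP hb].
- apply/suppYP => i j; rewrite negb_or => /andP[_ /negPf ne_ij].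
  by rewrite mxE ne_ij.
- by apply/suppYP => i j nY; rewrite !mxE ha ?hb ?subr0.
apply/suppYP => i j nY; rewrite mxE big1 // => l _.
have [il|/ha ->] := boolP (inY s i l); last by rewrite mul0r.
have [lj|/hb ->] := boolP (inY s l j); last by rewrite mulr0.
by rewrite (inY_trans il lj) in nY.
Qed.

Lemma suppY_submod : submod_closed suppY.
Proof.
split=> [|c a b /suppYP ha /suppYP hb]; apply/suppYP => i j nY.
  by rewrite mxE.
by rewrite !mxE ha ?hb ?mulr0 ?addr0.
Qed.

Lemma suppX_submod : submod_closed suppX.
Proof.
split=> [|c a b /suppXP ha /suppXP hb]; apply/suppXP => i j nX.
  by rewrite mxE.
by rewrite !mxE ha ?hb ?mulr0 ?addr0.
Qed.

Record algA := AlgA { mxA :> 'M[k]_n; mxAP : mxA \in suppY }.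
HB.instance Definition _ := [isSub for mxA].
HB.instance Definition _ := [Choice of algA by <:].
HB.instance Definition _ := GRing.SubChoice_isSubPzRing.Build 'M[k]_n suppY algA
  suppY_subring.
HB.instance Definition _ := GRing.SubZmodule_isSubLmodule.Build k 'M[k]_n suppY
  algA suppY_submod.

Record modD := ModD { mxD :> 'M[k]_n; mxDP : mxD \in suppX }.
HB.instance Definition _ := [isSub for mxD].
HB.instance Definition _ := [Choice of modD by <:].
HB.instance Definition _ := GRing.SubChoice_isSubLmodule.Build k 'M[k]_n suppX
  modD suppX_submod.

Lemma lact_subproof (a : algA) (d : modD) : mxA a *m mxD d \in suppX.
Proof.
apply/suppXP => i j nX; rewrite mxE big1 // => l _.
have [il|/(suppYP _ (mxAP a)) ->] := boolP (inY s i l); last by rewrite mul0r.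
have [lj|/(suppXP _ (mxDP d)) ->] := boolP (inX s l j); last by rewrite mulr0.
by rewrite (inYX_trans il lj) in nX.
Qed.

Lemma ract_subproof (d : modD) (a : algA) : mxD d *m mxA a \in suppX.
Proof.
apply/suppXP => i j nX; rewrite mxE big1 // => l _.
have [il|/(suppXP _ (mxDP d)) ->] := boolP (inX s i l); last by rewrite mul0r.
have [lj|/(suppYP _ (mxAP a)) ->] := boolP (inY s l j); last by rewrite mulr0.
by rewrite (inXY_trans il lj) in nX.
Qed.

Definition lact (a : algA) (d : modD) : modD := ModD (lact_subproof a d).
Definition ract (d : modD) (a : algA) : modD := ModD (ract_subproof d a).

Lemma algA_scaleAl (c : k) (a b : algA) : (c *: a) * b = c *: (a * b).
Proof. by apply: val_inj; apply/esym/scalemxAl. Qed.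

Lemma algA_scaleAr (c : k) (a b : algA) : a * (c *: b) = c *: (a * b).
Proof. by apply: val_inj; apply/esym/scalemxAr. Qed.

Lemma lact1 d : lact 1 d = d.
Proof. by apply: val_inj; apply: mul1mx. Qed.

Lemma ract1 d : ract d 1 = d.
Proof. by apply: val_inj; apply: mulmx1. Qed.

Lemma lactM a b d : lact (a * b) d = lact a (lact b d).
Proof. by apply: val_inj; apply/esym/mulmxA. Qed.

Lemma ractM d a b : ract d (a * b) = ract (ract d a) b.
Proof. by apply: val_inj; apply: mulmxA. Qed.

Lemma lractA a d b : ract (lact a d) b = lact a (ract d b).
Proof. by apply: val_inj; apply/esym/mulmxA. Qed.

Definition alpha (i j : 'I_n) : algA := insubd (0 : algA) (delta_mx i j).
Definition beta (i j : 'I_n) : modD := insubd (0 : modD) (delta_mx i j).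

Lemma mx_alpha i j : inY s i j -> mxA (alpha i j) = delta_mx i j.
Proof.
move=> Yij; rewrite /alpha -[mxA _]/(val _) insubdK //.
apply/suppYP => a b; rewrite mxE.
by have [->|_] := eqVneq a i; have [->|_] := eqVneq b j; rewrite ?Yij.
Qed.

Lemma mx_beta i j : inX s i j -> mxD (beta i j) = delta_mx i j.
Proof.
move=> Xij; rewrite /beta -[mxD _]/(val _) insubdK //.
apply/suppXP => a b; rewrite mxE.
by have [->|_] := eqVneq a i; have [->|_] := eqVneq b j; rewrite ?Xij.
Qed.

Lemma alphaM i j l m : inY s i j -> inY s l m ->
  alpha i j * alpha l m = if j == l then alpha i m else 0.
Proof.
move=> ij lm; apply: val_inj.
transitivity (mxA (alpha i j) *m mxA (alpha l m)); first by [].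
rewrite !mx_alpha //.
have [jl|ne_jl] := eqVneq j l; last by rewrite mul_delta_mx_0.
rewrite -jl mul_delta_mx -[RHS]/(mxA _) mx_alpha //; rewrite -jl in lm.
exact: inY_trans lm.
Qed.

Lemma alpha_beta i j l m : inY s i j -> inX s l m ->
  lact (alpha i j) (beta l m) = if j == l then beta i m else 0.
Proof.
move=> ij lm; apply: val_inj.
transitivity (mxA (alpha i j) *m mxD (beta l m)); first by [].
rewrite mx_alpha // mx_beta //.
have [jl|ne_jl] := eqVneq j l; last by rewrite mul_delta_mx_0.
rewrite -jl mul_delta_mx -[RHS]/(mxD _) mx_beta //; rewrite -jl in lm.
exact: inYX_trans lm.
Qed.

Lemma beta_alpha i j l m : inX s i j -> inY s l m ->
  ract (beta i j) (alpha l m) = if j == l then beta i m else 0.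
Proof.
move=> ij lm; apply: val_inj.
transitivity (mxD (beta i j) *m mxA (alpha l m)); first by [].
rewrite mx_alpha // mx_beta //.
have [jl|ne_jl] := eqVneq j l; last by rewrite mul_delta_mx_0.
rewrite -jl mul_delta_mx -[RHS]/(mxD _) mx_beta //; rewrite -jl in lm.
exact: inXY_trans lm.
Qed.

Lemma mxAZ (c : k) (a : algA) : mxA (c *: a) = c *: mxA a.
Proof. by []. Qed.

Lemma mxDZ (c : k) (d : modD) : mxD (c *: d) = c *: mxD d.
Proof. by []. Qed.

Lemma mxA_sum (I : Type) (r : seq I) (P : pred I) (F : I -> algA) :
  mxA (\sum_(i <- r | P i) F i) = \sum_(i <- r | P i) mxA (F i).
Proof. exact: (big_morph mxA (fun _ _ => erefl) erefl). Qed.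

Lemma mxD_sum (I : Type) (r : seq I) (P : pred I) (F : I -> modD) :
  mxD (\sum_(i <- r | P i) F i) = \sum_(i <- r | P i) mxD (F i).
Proof. exact: (big_morph mxD (fun _ _ => erefl) erefl). Qed.

Lemma alpha_unit : 1 = \sum_i alpha i i.
Proof.
apply: val_inj; rewrite -[RHS]/(mxA _) mxA_sum.
rewrite (eq_bigr (fun i => delta_mx i i)) => [|i _].
  by rewrite -mx1_sum_delta.
by rewrite mx_alpha // /inY eqxx orbT.
Qed.

Lemma alpha_span (a : algA) :
  a = \sum_(p : 'I_n * 'I_n | inY s p.1 p.2) a p.1 p.2 *: alpha p.1 p.2.
Proof.
apply: val_inj; rewrite -[RHS]/(mxA _) -[LHS]/(mxA _) mxA_sum.
rewrite [LHS]matrix_sum_delta pair_bigA.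
rewrite [RHS](eq_bigr (fun p => a p.1 p.2 *: delta_mx p.1 p.2)) => [|p Yp];
  last first.
  by rewrite mxAZ mx_alpha.
rewrite [RHS]big_mkcond; apply: eq_bigr => -[i j] _ /=.
by case: ifPn => // /(suppYP _ (mxAP a)) ->; rewrite scale0r.
Qed.

Lemma alpha_free (c : 'I_n -> 'I_n -> k) i j : inY s i j ->
  mxA (\sum_(p : 'I_n * 'I_n | inY s p.1 p.2) c p.1 p.2 *: alpha p.1 p.2) i j
  = c i j.
Proof.
move=> Yij; rewrite mxA_sum summxE.
rewrite (eq_bigr (fun p => c p.1 p.2 * delta_mx p.1 p.2 i j)) => [|p Yp].
  rewrite (bigD1 (i, j)) //= big1 => [|[a b] /= /andP[_ ne]].
    by rewrite mxE !eqxx mulr1 addr0.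
  rewrite mxE [i == a]eq_sym [j == b]eq_sym.
  by rewrite -[_ && _]/((a, b) == (i, j)) (negPf ne) mulr0.
by rewrite mxAZ mxE mx_alpha.
Qed.

Lemma beta_span (d : modD) :
  d = \sum_(p : 'I_n * 'I_n | inX s p.1 p.2) d p.1 p.2 *: beta p.1 p.2.
Proof.
apply: val_inj; rewrite -[RHS]/(mxD _) -[LHS]/(mxD _) mxD_sum.
rewrite [LHS]matrix_sum_delta pair_bigA.
rewrite [RHS](eq_bigr (fun p => d p.1 p.2 *: delta_mx p.1 p.2)) => [|p Xp];
  last first.
  by rewrite mxDZ mx_beta.
rewrite [RHS]big_mkcond; apply: eq_bigr => -[i j] _ /=.
by case: ifPn => // /(suppXP _ (mxDP d)) ->; rewrite scale0r.
Qed.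

Lemma beta_free (c : 'I_n -> 'I_n -> k) i j : inX s i j ->
  mxD (\sum_(p : 'I_n * 'I_n | inX s p.1 p.2) c p.1 p.2 *: beta p.1 p.2) i j
  = c i j.
Proof.
move=> Xij; rewrite mxD_sum summxE.
rewrite (eq_bigr (fun p => c p.1 p.2 * delta_mx p.1 p.2 i j)) => [|p Xp].
  rewrite (bigD1 (i, j)) //= big1 => [|[a b] /= /andP[_ ne]].
    by rewrite mxE !eqxx mulr1 addr0.
  rewrite mxE [i == a]eq_sym [j == b]eq_sym.
  by rewrite -[_ && _]/((a, b) == (i, j)) (negPf ne) mulr0.
by rewrite mxDZ mxE mx_beta.
Qed.

Record unitA := UnitA {
  uval :> algA;
  uinv : algA;
  uvalV : uval * uinv = 1;
  uinvV : uinv * uval = 1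
}.

Definition conjD (g : unitA) (d : modD) : modD := ract (lact g d) (uinv g).

Definition Smap (lam : modD) (a : algA) : modD := lact a lam - ract lam a.

(* A lam A = D, where A lam A is the set of finite sums of elements a lam b. *)
Definition Dgen (lam : modD) : Prop :=
  forall mu : modD, exists (m : nat) (a b : 'I_m -> algA),
    mu = \sum_(t < m) ract (lact (a t) lam) (b t).

Definition is_orbit (O : modD -> Prop) : Prop :=
  exists lam, forall mu, O mu <-> exists g : unitA, conjD g lam = mu.

Definition acts_transitively_on (U : modD -> Prop) : Prop :=
  [/\ forall g lam, U lam -> U (conjD g lam),
      exists lam, U lam &
      forall lam mu, U lam -> U mu -> exists g : unitA, conjD g lam = mu].

End AlgebraA.

(* The Zariski topology on a set E of points of affine space with finitely many
   coordinate functions x_. *)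

Section Zariski.
Variables (k : fieldType) (E : Type) (I : finType) (x_ : I -> E -> k).

Definition zariski_closed (Z : E -> Prop) : Prop :=
  exists P : {mpoly k[#|I|]} -> Prop, forall e,
    Z e <-> (forall p, P p -> p.@[fun t => x_ (enum_val t) e] = 0).

Definition zariski_open (U : E -> Prop) : Prop :=
  zariski_closed (fun e => ~ U e).

Definition zariski_closure (S : E -> Prop) : E -> Prop :=
  fun e => forall Z, zariski_closed Z -> (forall e', S e' -> Z e') -> Z e.

End Zariski.

Definition coordD (k : fieldType) (n : nat) (s : 'S_n)
    (p : {p : 'I_n * 'I_n | inX s p.1 p.2}) (lam : modD k s) : k :=
  lam (val p).1 (val p).2.

Definition open_orbit (k : fieldType) (n : nat) (s : 'S_n)
    (O : modD k s -> Prop) : Prop :=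
  is_orbit O /\ zariski_open (@coordD k n s) O.

(* Representations of the linear quiver 1 -> 2 -> ... -> N and modules over its
   preprojective algebra.  Spaces are indexed by all v : nat, those outside
   [1, N] being zero; they are 'cV[k]_(d v), and linear maps are matrices acting
   on the left, so that composition is *m in the usual order. *)

Section Quiver.
Variable k : fieldType.

Record qrep := QRep {
  qdim : nat -> nat;
  qmap : forall v, 'M[k]_(qdim v.+1, qdim v)
}.

(* M([a,b]): const_mx 1 is the identity of k when v and v+1 lie in [a,b], and an
   empty matrix otherwise. *)
Definition interval_rep (a b : nat) : qrep :=
  @QRep (fun v => nat_of_bool (a <= v <= b)%N) (fun v => const_mx 1).

(* Block diagonal maps; on the diagonal the dimensions agree, so conform_mx
   returns its second argument. *)
Definition qrep_sum (m : nat) (R : 'I_m -> qrep) : qrep :=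
  @QRep (fun v => \sum_(i < m) qdim (R i) v)%N
    (fun v => \mxblock_(i < m, j < m)
       (if i == j then conform_mx 0 (qmap (R i) v) else 0)).

Definition qrep_iso (R R' : qrep) : Prop :=
  exists (f : forall v, 'M[k]_(qdim R' v, qdim R v))
         (g : forall v, 'M[k]_(qdim R v, qdim R' v)),
    [/\ forall v, f v *m g v = 1%:M,
        forall v, g v *m f v = 1%:M &
        forall v, f v.+1 *m qmap R v = qmap R' v *m f v].

(* The points of Lambda(V) for V of graded dimension d.  The relation at the
   vertex 0 is vacuous as V_0 = 0. *)
Record Lambda (d : nat -> nat) := LambdaPt {
  LT : forall v, 'M[k]_(d v.+1, d v);
  LB : forall v, 'M[k]_(d v, d v.+1);
  Lrel : forall v, LT v *m LB v = LB v.+1 *m LT v.+1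
}.

(* Coordinates on Lambda(V) for V supported on [1, N]. *)
Definition Lcoord_index (N : nat) (d : nat -> nat) : finType :=
  ({v : 'I_N & ('I_(d v.+1) * 'I_(d v))%type}
   + {v : 'I_N & ('I_(d v) * 'I_(d v.+1))%type})%type.

Definition Lcoord (N : nat) (d : nat -> nat) (c : Lcoord_index N d)
    (x : Lambda d) : k :=
  match c with
  | inl t => LT x (tag t) (tagged t).1 (tagged t).2
  | inr t => LB x (tag t) (tagged t).1 (tagged t).2
  end.

Variable N : nat.

Record pimod := PiMod {
  pdim : nat -> nat;
  psupp : forall v, ~~ (0 < v <= N)%N -> pdim v = 0%N;
  pstr :> Lambda pdim
}.

Record pihom (X Y : pimod) := PiHom {
  hmap :> forall v, 'M[k]_(pdim Y v, pdim X v);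
  hmapT : forall v, hmap v.+1 *m LT X v = LT Y v *m hmap v;
  hmapB : forall v, hmap v *m LB X v = LB Y v *m hmap v.+1
}.

(* Short exact sequences 0 -> Y -> E -> X -> 0. *)
Record extension (X Y : pimod) := Extension {
  emod : pimod;
  einj : pihom Y emod;
  esurj : pihom emod X;
  einjP : forall v (u : 'cV[k]_(pdim Y v)), einj v *m u = 0 -> u = 0;
  esurjP : forall v (w : 'cV[k]_(pdim X v)), exists u, esurj v *m u = w;
  eexact : forall v (u : 'cV[k]_(pdim emod v)),
    esurj v *m u = 0 <-> exists w, u = einj v *m w
}.

Definition ext_equiv (X Y : pimod) (E E' : extension X Y) : Prop :=
  exists phi : pihom (emod E) (emod E'),
    (forall v, phi v *m einj E v = einj E' v) /\
    (forall v, esurj E' v *m phi v = esurj E v).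

Section Split.
Variables X Y : pimod.

Lemma split_rel v :
  block_mx (LT Y v) 0 0 (LT X v) *m block_mx (LB Y v) 0 0 (LB X v) =
  block_mx (LB Y v.+1) 0 0 (LB X v.+1) *m block_mx (LT Y v.+1) 0 0 (LT X v.+1).
Proof. by rewrite !mulmx_block !mulmx0 !mul0mx !addr0 !add0r !Lrel. Qed.

Lemma split_supp v : ~~ (0 < v <= N)%N -> (pdim Y v + pdim X v = 0)%N.
Proof. by move=> nv; rewrite !psupp. Qed.

Definition split_mod : pimod := PiMod split_supp (LambdaPt split_rel).

Lemma split_injT v :
  col_mx 1%:M 0 *m LT Y v = LT split_mod v *m col_mx 1%:M 0.
Proof.
by rewrite mul_col_mx mul_block_col mul1mx !mulmx1 !mulmx0 !mul0mx !addr0.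
Qed.

Lemma split_injB v :
  col_mx 1%:M 0 *m LB Y v = LB split_mod v *m col_mx 1%:M 0.
Proof.
by rewrite mul_col_mx mul_block_col mul1mx !mulmx1 !mulmx0 !mul0mx !addr0.
Qed.

Definition split_inj : pihom Y split_mod :=
  @PiHom Y split_mod (fun v => col_mx 1%:M 0) split_injT split_injB.

Lemma split_surjT v :
  row_mx 0 1%:M *m LT split_mod v = LT X v *m row_mx 0 1%:M.
Proof.
by rewrite mul_mx_row mul_row_block !mul1mx !mulmx1 !mulmx0 !mul0mx !add0r.
Qed.

Lemma split_surjB v :
  row_mx 0 1%:M *m LB split_mod v = LB X v *m row_mx 0 1%:M.
Proof.
by rewrite mul_mx_row mul_row_block !mul1mx !mulmx1 !mulmx0 !mul0mx !add0r.
Qed.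

Definition split_surj : pihom split_mod X :=
  @PiHom split_mod X (fun v => row_mx 0 1%:M) split_surjT split_surjB.

Lemma split_injP v (u : 'cV[k]_(pdim Y v)) : split_inj v *m u = 0 -> u = 0.
Proof.
rewrite mul_col_mx mul1mx => /(congr1 usubmx).
by rewrite col_mxKu linear0.
Qed.

Lemma split_surjP v (w : 'cV[k]_(pdim X v)) : exists u, split_surj v *m u = w.
Proof. by exists (col_mx 0 w); rewrite mul_row_col mul0mx mul1mx add0r. Qed.

Lemma split_exact v (u : 'cV[k]_(pdim split_mod v)) :
  split_surj v *m u = 0 <-> exists w, u = split_inj v *m w.
Proof.
split=> [|[w ->]]; last first.
  by rewrite mul_col_mx mul_row_col mul1mx !mul0mx mul1mx addr0.
rewrite -[u]vsubmxK mul_row_col mul0mx mul1mx add0r => ->.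
by exists (usubmx u); rewrite mul_col_mx mul1mx mul0mx.
Qed.

Definition split_ext : extension X Y :=
  @Extension X Y split_mod split_inj split_surj split_injP split_surjP
    split_exact.

End Split.

(* Ext^1_Pi(X, Y) = 0, for Ext^1 the Yoneda group of classes of extensions, whose
   zero is the class of the split one.  Extensions of finite-dimensional modules
   are finite-dimensional, so it suffices to consider middle terms in pimod. *)
Definition Ext1_zero (X Y : pimod) : Prop :=
  forall E : extension X Y, ext_equiv E (split_ext X Y).

End Quiver.

Section Rigid.
Variables (k : fieldType) (n : nat) (s : 'S_n).

Definition Mrep : qrep k :=
  qrep_sum (fun i : 'I_n => interval_rep k i.+1 (2 * n - (s i).+1)).

Lemma Mrep_supp v : ~~ (0 < v <= 2 * n - 1)%N -> qdim Mrep v = 0%N.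
Proof.
move=> nv; rewrite /= big1 // => i _; apply/eqP; rewrite eqb0.
apply: contra nv => /andP[lt_iv le_v].
rewrite (leq_ltn_trans _ lt_iv) //= (leq_trans le_v) //.
by rewrite leq_sub2l.
Qed.

Definition Csigma : Lambda k (qdim Mrep) -> Prop :=
  zariski_closure (@Lcoord k (2 * n - 1) (qdim Mrep))
    (fun x => qrep_iso (QRep (LT x)) Mrep).

Definition rigid : Prop :=
  exists x : Lambda k (qdim Mrep),
    Csigma x /\ Ext1_zero (PiMod Mrep_supp x) (PiMod Mrep_supp x).

End Rigid.

(* Main.v *)
Require Import Defs.
From HB Require Import structures.
From mathcomp Require Import all_boot all_order all_fingroup all_algebra.
From mathcomp Require Import mpoly.
From mathcomp Require Import zify ring.
From Stdlib Require Import Classical.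

Set Implicit Arguments.
Unset Strict Implicit.
Unset Printing Implicit Defensive.

(** The relation [inX s] is a strict partial order on the positions, [algA] is its
    incidence algebra and [modD] the radical.  Both the transitivity on [Dgen] and
    the surjectivity of [Smap] ask for solutions [a] in [algA] of an equation
    [a lam - mu a = nu], where [lam] and [mu] are generators, that is, have nonzero
    entries at the covers of the order ([Dgen_cover]).

    The heart of the proof is combinatorial ([smooth_peelable]): if [s] avoids 3412
    and 4231, every nonempty set of positions has a minimal element above which the
    set is a chain, or a maximal element below which it is a chain.  Removing such
    an element [d], one solves the equation for the remaining positions by
    induction.  If [d] is minimal, row [d] remains to be found; its equations form
    a triangular system indexed by the chain above [d], with the cover entries of
    [lam] as pivots ([row_step]).  If [d] is maximal, one transposes.  For [nu = 0]
    the solution has a nonzero diagonal, so it is a unit of [algA] that conjugates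
    [lam] into [mu]; for [lam = mu] it exhibits [nu] as a commutator with [lam].

    So [Dgen] is one orbit, and it is open as the set where a product of
    coordinates does not vanish.  Any other open orbit meets it, because the field
    is infinite ([open_orbit_unique]).

    For rigidity, a generator [lam] defines a point of [Csigma]: keep the maps [T]
    of [Mrep] and let [lam] be the matrix of the maps [B].  A self-extension of this
    module is given by a cocycle [(tau, beta)].  The class of [tau] among the
    self-extensions of [Mrep] is determined by finitely many sums of entries, which
    pair with [modD].  The cocycle condition makes [tau] orthogonal to all
    commutators of [lam] with the endomorphism algebra [algA] of [Mrep], hence to
    all of [modD], so [tau] is a coboundary ([tau_trivial]) and may be taken to be
    zero.  Then [beta] itself is given by an element of [modD], which is again a
    commutator with [lam]; this makes it a coboundary ([beta_trivial]). *)

Import GRing.Theory.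
Local Open Scope ring_scope.

(** * Peeling the inversion order of a smooth permutation *)

Section Elimination.
Variable n : nat.

Definition chain_above (R : rel 'I_n) (S : {set 'I_n}) (d : 'I_n) : Prop :=
  (forall i, i \in S -> ~~ R i d) /\
  (forall i j, i \in S -> j \in S -> R d i -> R d j -> i != j -> R i j || R j i).

Definition converse (R : rel 'I_n) : rel 'I_n := fun i j => R j i.

Definition peelable (R : rel 'I_n) : Prop :=
  forall S : {set 'I_n}, S != set0 -> exists2 d, d \in S &
    chain_above R S d \/ chain_above (converse R) S d.

Lemma no_pattern (s : 'S_n) (p : seq nat) (x : 'I_n) (t : seq 'I_n) :
  ~ contains_pattern s p -> size t = size p ->
  pairwise (fun i j : 'I_n => i < j)%N t ->
  (forall a b, (a < size p)%N -> (b < size p)%N ->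
     (s (nth x t a) < s (nth x t b))%N = (nth 0%N p a < nth 0%N p b)%N) -> False.
Proof.
move=> no st ti ts; apply: no.
exists (fun i => nth x t i); split=> a b; last exact: ts.
by move=> ab; move/(pairwiseP x): ti; apply=> //; rewrite inE st; apply: ltn_ord.
Qed.

Lemma no_3412 (s : 'S_n) (a b c d : 'I_n) :
  ~ contains_pattern s [:: 3; 4; 1; 2]%N -> (a < b < c)%N -> (c < d)%N ->
  (s c < s d < s a)%N -> (s a < s b)%N -> False.
Proof.
move=> no ab_bc cd val_cda sab.
apply: (no_pattern (x := a) (t := [:: a; b; c; d]) no) => //=; first by lia.
by case=> [|[|[|[|x]]]] // [|[|[|[|y]]]] // _ _ /=; lia.
Qed.

Lemma no_4231 (s : 'S_n) (a b c d : 'I_n) :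
  ~ contains_pattern s [:: 4; 2; 3; 1]%N -> (a < b < c)%N -> (c < d)%N ->
  (s d < s b < s c)%N -> (s c < s a)%N -> False.
Proof.
move=> no ab_bc cd val_dbc sca.
apply: (no_pattern (x := a) (t := [:: a; b; c; d]) no) => //=; first by lia.
by case=> [|[|[|[|x]]]] // [|[|[|[|y]]]] // _ _ /=; lia.
Qed.

(** Candidates are the position [d] of the largest value in [S] and the last
    position [e] in [S].  If the positions after [d] carry an ascent [x < y] and
    the values above that of [e] carry an ascent [u < v], then avoiding 4231 on
    [d, x, y, e] puts the value at [x] below that at [e], and avoiding it on
    [d, u, v, e] puts [u] before [d]; now [u, d, x, e] is a 3412 pattern. *)
Lemma smooth_peelable (s : 'S_n) : smooth s -> peelable (inX s).
Proof.
case=> no3412 no4231 S /set0Pn[z zS].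
have [d dS maxd] : {d | d \in S & forall i, i \in S -> (s i <= s d)%N}.
  by case: (arg_maxnP (fun i => s i : nat) zS) => d ? ?; exists d.
have [e eS maxe] : {e | e \in S & forall i, i \in S -> (i <= e)%N}.
  by case: (arg_maxnP (fun i : 'I_n => i : nat) zS) => e ? ?; exists e.
have sinj (x y : 'I_n) : x <> y :> nat -> s x <> s y :> nat.
  by move=> ne /val_inj/perm_inj/(congr1 val).
have [/existsP[x /existsP[y /and5P[xS yS dx xy sxy]]]|chd] :=
  boolP [exists x, exists y, [&& x \in S, y \in S, (d < x)%N, (x < y)%N &
    (s x < s y)%N]]; last first.
  exists d => //; left; split=> [i iS|i j iS jS /andP[di _] /andP[dj _] ne].
    by rewrite /inX negb_and -!leqNgt maxd // orbT.
  move: chd; rewrite negb_exists => /forallP chd.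
  have ci := chd i; have cj := chd j.
  move: ci cj; rewrite !negb_exists => /forallP/(_ j) ci /forallP/(_ i) cj.
  have := sinj i j; have : i <> j :> nat by move/val_inj/eqP; apply/negP.
  move: ci cj; rewrite /inX iS jS di dj /=; lia.
have [/existsP[u /existsP[v /and5P[uS vS su uv suv]]]|che] :=
  boolP [exists x, exists y, [&& x \in S, y \in S, (s e < s x)%N, (x < y)%N &
    (s x < s y)%N]]; last first.
  exists e => //; right; split=> [i iS|i j iS jS /andP[_ di] /andP[_ dj] ne].
    by rewrite /converse /inX negb_and -!leqNgt maxe // orTb.
  move: che; rewrite negb_exists => /forallP chd.
  have ci := chd i; have cj := chd j.
  move: ci cj; rewrite !negb_exists => /forallP/(_ j) ci /forallP/(_ i) cj.
  have := sinj i j; have : i <> j :> nat by move/val_inj/eqP; apply/negP.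
  move: ci cj; rewrite /converse /inX iS jS di dj /=; lia.
exfalso.
have ? := maxd _ yS; have ? := maxe _ yS.
have ? := maxd _ vS; have ? := maxe _ vS; have ? := maxd _ uS.
have ? := maxd _ eS.
have Dy : y <> d :> nat by lia.
have Dyd := sinj _ _ Dy.
have Dv := sinj v d; have Du := sinj u d; have Dx := sinj x e.
have Dvs : v = d :> nat -> s v = s d :> nat by move/val_inj->.
have Des : y = e :> nat -> s y = s e :> nat by move/val_inj->.
have Dve : v = e :> nat -> s v = s e :> nat by move/val_inj->.
have [lt_sxe|le_sxe] := ltnP (s x) (s e); last first.
  by apply: (@no_4231 s d x y e) => //; lia.
have [lt_ud|le_du] := ltnP u d; first by apply: (@no_3412 s u d x e) => //; lia.
have ? : u <> d :> nat by move=> /val_inj ud; subst u; lia.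
by apply: (@no_4231 s d u v e) => //; lia.
Qed.
End Elimination.

(** * The intertwining equation over a peelable order *)

Definition strict_order n (R : rel 'I_n) : Prop := irreflexive R /\ transitive R.

Lemma strict_order_asym n (R : rel 'I_n) i j :
  strict_order R -> R i j -> R j i = false.
Proof. by case=> irr tr ij; apply/negP => /(tr _ _ _ ij); rewrite irr. Qed.

Lemma strict_order_converse n (R : rel 'I_n) :
  strict_order R -> strict_order (converse R).
Proof.
case=> irr tr; split=> [i|j i l] /=; rewrite /converse ?irr // => ji lj.
exact: tr lj ji.
Qed.

Definition supported (k : fieldType) n (R : rel 'I_n) (L : 'M[k]_n) : Prop :=
  forall i j, ~~ R i j -> L i j = 0.

(** Along a chain [c, cs] the system is triangular with the entries [L a b] at
    consecutive [a, b] as pivots, so it is solved by adjusting the coordinate at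
    the last element each time the chain is prolonged. *)
Lemma chain_solve (k : fieldType) n (R : rel 'I_n) (L : 'M[k]_n)
    (w : 'rV[k]_n) c cs :
  strict_order R -> supported R L ->
  path (fun a b => L a b != 0) c cs -> pairwise R (c :: cs) ->
  exists x : 'rV[k]_n, (forall j, j \notin c :: cs -> x 0 j = 0) /\
    forall b, b \in cs -> (x *m L) 0 b = w 0 b.
Proof.
move=> so suL; elim/last_ind: cs => [|cs b IH].
  by move=> _ _; exists 0; split=> // j _; rewrite mxE.
rewrite rcons_path -rcons_cons pairwise_rcons => /andP[pcs Lb] /andP[allb pw].
have [x [x0 xE]] := IH pcs pw.
set p := last c cs in Lb.
pose y := (w 0 b - (x *m L) 0 b) / L p b.
have pin : p \in c :: cs by apply: mem_last.
exists (x + y *: delta_mx 0 p); split=> [j|j].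
  rewrite mem_rcons in_cons negb_or => /andP[jb jcs].
  rewrite !mxE x0 // (_ : j == p = false) ?andbF ?mulr0 ?addr0 //.
  by apply: contraNF jcs => /eqP->.
have E i : ((x + y *: delta_mx 0 p) *m L) 0 i = (x *m L) 0 i + y * L p i.
  by rewrite mulmxDl -scalemxAl -rowE !mxE.
rewrite mem_rcons in_cons E => /orP[/eqP->|jcs].
  by rewrite /y mulfVK // addrC subrK.
rewrite xE //; suff -> : L p j = 0 by rewrite mulr0 addr0.
apply: suL; move: (jcs) pw; have : j \in c :: cs by rewrite in_cons jcs orbT.
rewrite lastI mem_rcons in_cons pairwise_rcons -/p => + _ /andP[/allP ap _].
case/orP=> [/eqP->|/ap jp]; first by case: so => ->.
by rewrite (strict_order_asym so jp).
Qed.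

Section RowStep.
Variables (k : fieldType) (n : nat).
Implicit Types (R : rel 'I_n) (S : {set 'I_n}) (lam mu nu : 'M[k]_n).

Definition between R S i j : bool := [exists l in S, R i l && R l j].

Definition covers_nonzero R S lam : Prop :=
  forall i j, i \in S -> j \in S -> R i j -> ~~ between R S i j -> lam i j != 0.

(** A solution, on the rows and columns of [S], of the intertwining equation
    [a *m lam - mu *m a = nu].  For [nu = 0] it intertwines [lam] and [mu], and
    the condition on the diagonal makes it invertible when [S] is the whole order;
    for [lam = mu] it shows that [nu] is a commutator with [lam]. *)
Definition solves R S lam mu nu (a : 'M[k]_n) : Prop :=
  [/\ forall i j, a i j != 0 -> [&& i \in S, j \in S & R i j || (i == j)],
      forall i j, i \in S -> j \in S -> (a *m lam - mu *m a) i j = nu i j &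
      nu = 0 -> forall i, i \in S -> a i i != 0].

Lemma covers_nonzero_remove R S d lam : strict_order R ->
  ((forall i, i \in S -> ~~ R i d) \/ (forall i, i \in S -> ~~ R d i)) ->
  covers_nonzero R S lam -> covers_nonzero R (S :\ d) lam.
Proof.
move=> so ext cov i j /setD1P[id iS] /setD1P[jd jS] ij nb.
apply: cov => //; apply: contra nb => /existsP[l /and3P[lS il lj]].
apply/existsP; exists l; rewrite !inE lS il lj !andbT.
by apply/eqP => ld; subst l; case: ext => [/(_ i iS)|/(_ j jS)]; rewrite ?il ?lj.
Qed.

(** The elements above [d] are pairwise comparable and can be sorted; whatever lies
    between two of them is above [d], hence in the list, so that consecutive
    members are covers in [S]. *)
Lemma chain_enum R S d : strict_order R -> d \in S -> chain_above R S d ->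
  exists cs : seq 'I_n, [/\ pairwise R (d :: cs),
    forall j, (j \in cs) = (j \in S) && R d j &
    path (fun i j => ~~ between R S i j) d cs].
Proof.
move=> so dS [dmin dch]; have [irr tr] := so.
pose U := enum [set j in S | R d j].
pose Re : rel 'I_n := fun i j => R i j || (i == j).
have tot : {in mem U &, total Re}.
  move=> i j; rewrite !mem_enum !inE => /andP[iS di] /andP[jS dj].
  have [->|ne] := eqVneq i j; first by rewrite /Re eqxx orbT.
  by have := dch i j iS jS di dj ne; rewrite /Re => /orP[->|->]; rewrite ?orbT.
have tre : transitive Re.
  move=> j i l /orP[ij|/eqP-> //] /orP[jl|/eqP<-]; rewrite /Re ?ij //.
  by rewrite (tr _ _ _ ij jl).
pose cs := sort Re U.
have mcs j : (j \in cs) = (j \in S) && R d j by rewrite mem_sort mem_enum inE.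
have pcs : pairwise R cs.
  have := sort_sorted_in tot (allss U); rewrite (sorted_pairwise tre) -/cs => sp.
  have : uniq cs by rewrite sort_uniq enum_uniq.
  rewrite uniq_pairwise => up.
  have : pairwise [rel x y | Re x y && (x != y)] cs by rewrite pairwise_relI sp.
  by apply: sub_pairwise => i j /andP[/orP[//|->]].
have pdcs : pairwise R (d :: cs).
  by rewrite /= pcs andbT; apply/allP => j; rewrite mcs => /andP[].
exists cs; split=> //.
have so' : sorted R (d :: cs) by apply: pairwise_sorted.
apply/(pathP d) => i ltics; apply/negP => /existsP[l /and3P[lS il lj]].
have lcs : l \in cs.
  rewrite mcs lS /=; have : nth d (d :: cs) i \in d :: cs.
    by rewrite mem_nth //= ltnS ltnW.
  rewrite in_cons => /orP[/eqP Ei|]; first by rewrite -Ei.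
  by rewrite mcs => /andP[_ /tr]; apply.
have lcs' : l \in d :: cs by rewrite in_cons lcs orbT.
have El := nth_index d lcs'; set m := index l (d :: cs) in El.
have ltm : (m < (size cs).+1)%N.
  by rewrite -[X in (_ < X)%N]/(size (d :: cs)) index_mem.
have mono (u v : nat) : (u < v)%N -> (v < (size cs).+1)%N ->
    R (nth d (d :: cs) u) (nth d (d :: cs) v).
  move=> uv lv; apply: (sorted_ltn_nth tr) => //; rewrite inE //.
  exact: ltn_trans lv.
have [lt_im|le_mi] := ltnP i m.
  move: lj; rewrite -El -[nth d cs i]/(nth d (d :: cs) i.+1).
  move: lt_im; rewrite leq_eqVlt => /orP[/eqP->|lt]; first by rewrite irr.
  by rewrite (strict_order_asym so (mono _ _ lt ltm)).
move: il; rewrite -El.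
move: le_mi; rewrite leq_eqVlt => /orP[/eqP->|lt]; first by rewrite irr.
rewrite (strict_order_asym so (mono _ _ lt _)) //.
by rewrite ltnS ltnW.
Qed.

(** As [d] is minimal, adding a row [x] at [d] to a solution [a'] on [S :\ d]
    leaves the equations of the other rows unchanged.  The equations of row [d]
    are [x *m lam = row d nu + row d mu *m a'], to be satisfied at the elements
    above [d]; these form a chain whose consecutive entries of [lam] are nonzero.
    At the first element of the chain the equation has a single term, the entry
    of [x] at [d] times an entry of [lam]; so this entry is nonzero for [nu = 0]. *)
Lemma row_step R S d lam mu nu a' : strict_order R -> d \in S -> chain_above R S d ->
  supported R lam -> supported R mu -> supported R nu ->
  covers_nonzero R S lam -> covers_nonzero R S mu ->
  solves R (S :\ d) lam mu nu a' ->
  exists a, solves R S lam mu nu a.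
Proof.
move=> so dS chd slam smu snu clam cmu [sa' ea' da'].
have [cs [pw mcs pcs]] := chain_enum so dS chd; have [irr tr] := so.
have [dmin _] := chd.
have a0 i j : ~~ [&& i \in S :\ d, j \in S :\ d & R i j || (i == j)] -> a' i j = 0.
  by move=> h; apply/eqP/negPn; apply: contra h; apply: sa'.
have dmem j : j \in d :: cs = (j \in S) && (R d j || (d == j)).
  rewrite in_cons mcs eq_sym; have [<-|] := eqVneq d j; first by rewrite dS orbT.
  by rewrite orbF.
pose w : 'rV[k]_n := row d nu + row d mu *m a'.
have wE j : w 0 j = nu d j + (mu *m a') d j by rewrite /w -row_mul !mxE.
have pL : path (fun a b => lam a b != 0) d cs.
  move: pw pcs => /pairwise_sorted /= pR pnb.
  have : all (mem S) (d :: cs) by apply/allP => j; rewrite dmem => /andP[].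
  elim: (cs) (d) pR pnb => //= b l IH c /andP[cb pb] /andP[ncb pnb].
  move=> /and3P[cS bS lS].
  by rewrite clam //= IH //= bS.
(* For an isolated [d] there is no equation, and the diagonal entry is set to 1. *)
have [x [x0 xE x1]] : exists x : 'rV[k]_n,
    [/\ (forall j, j \notin d :: cs -> x 0 j = 0),
      forall b, b \in cs -> (x *m lam) 0 b = w 0 b & (cs = [::] -> x 0 d = 1)].
  case: (cs) pL pw => [|c1 cs1] pL pw.
    exists (delta_mx 0 d); split=> // [j|_]; last by rewrite mxE !eqxx.
    by rewrite inE mxE => /negPf->; rewrite andbF.
  by have [x [x0 xE]] := chain_solve w so slam pL pw; exists x.
pose a : 'M[k]_n := \matrix_(i, j) if i == d then x 0 j else a' i j.
have aE i j : i != d -> a i j = a' i j by rewrite mxE => /negPf->.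
have adE j : a d j = x 0 j by rewrite mxE eqxx.
have a'd j : a' d j = 0 by rewrite a0 // !inE eqxx.
have a'd' j : a' j d = 0 by rewrite a0 // !inE eqxx andbF.
have mua i j : ~~ R i d -> (mu *m a) i j = (mu *m a') i j.
  move=> nR; rewrite !mxE; apply: eq_bigr => l _.
  have [->|ne] := eqVneq l d; last by rewrite aE.
  by rewrite (smu _ _ nR) !mul0r.
have rowE i j : i != d -> (a *m lam) i j = (a' *m lam) i j.
  by move=> ne; rewrite !mxE; apply: eq_bigr => l _; rewrite aE.
have rowd j : (a *m lam) d j = (x *m lam) 0 j.
  by rewrite !mxE; apply: eq_bigr => l _; rewrite adE.
have subE (A B : 'M[k]_n) i j : (A - B) i j = A i j - B i j by rewrite !mxE.
exists a; split.
- move=> i j; have [->|ne] := eqVneq i d.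
    by rewrite adE dS /= -dmem => /negP h; apply/negPn/negP => /x0/eqP.
  by rewrite aE // => /sa' /and3P[/setD1P[_ ->] /setD1P[_ ->]].
- move=> i j iS jS; rewrite subE mua ?dmin //.
  have [->|ne] := eqVneq i d; last first.
    have [->|nej] := eqVneq j d; last first.
      by rewrite rowE // -ea' ?inE ?iS ?jS ?ne ?nej //.
    rewrite rowE // (snu i d) ?dmin // [in X in X - _]mxE big1 => [|l _].
      by rewrite mxE big1 ?subrr // => l _; rewrite a'd' mulr0.
    have [/setD1P[_ lS]|nl] := boolP (l \in S :\ d); last first.
      by rewrite a0 ?mul0r // (negPf nl) andbF.
    by rewrite (slam l d) ?mulr0 ?dmin.
  rewrite rowd; have [jcs|ncs] := boolP (j \in cs).
    by rewrite xE // wE addrK.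
  have ndj : ~~ R d j by move: ncs; rewrite mcs jS.
  rewrite snu // mxE big1 => [|l _].
    rewrite mxE big1 ?subrr // => l _.
    have [dl|/smu ->] := boolP (R d l); last by rewrite mul0r.
    rewrite a0 ?mulr0 //; apply: contra ndj => /and3P[_ _].
    by case/orP=> [/(tr _ _ _ dl)//|/eqP<-].
  have [|/x0 ->] := boolP (l \in d :: cs); last by rewrite mul0r.
  rewrite dmem => /andP[_ dl]; rewrite slam ?mulr0 //; apply: contra ndj => lj.
  by case/orP: dl => [/tr|/eqP->]; first apply.
move=> nu0 i iS; have [->|ne] := eqVneq i d; last by rewrite aE // da' // !inE ne.
rewrite adE; case Ecs : cs => [|c1 cs1]; first by rewrite x1 // oner_eq0.
have c1cs : c1 \in cs by rewrite Ecs mem_head.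
have first l : l \in cs -> ~~ R l c1.
  rewrite Ecs in_cons => /orP[/eqP->|l1]; first by rewrite irr.
  move: pw; rewrite Ecs /= => /and3P[_ /allP/(_ l l1) c1l _].
  by rewrite (strict_order_asym so c1l).
have dc1 : R d c1 by move: c1cs; rewrite mcs => /andP[].
have c1S : c1 \in S by move: c1cs; rewrite mcs => /andP[].
have c1d : c1 != d by apply: contraTneq dc1 => ->; rewrite irr.
have nudc : nu d c1 = 0 by rewrite nu0 mxE.
have := xE c1 c1cs.
rewrite wE nudc add0r mxE (bigD1 d) //= big1 ?addr0 => [|l ne].
  rewrite mxE (bigD1 c1) //= big1 ?addr0 => [xc|l ne].
    have : mu d c1 * a' c1 c1 != 0.
      rewrite mulf_neq0 ?da' ?inE ?c1d //.
      apply: cmu => //; apply/negP => /existsP[l /and3P[lS dl lc]].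
      by have := first l; rewrite mcs lS dl lc => /(_ isT).
    by rewrite -xc; apply: contraNneq => ->; rewrite mul0r.
  have [dl|/smu ->] := boolP (R d l); last by rewrite mul0r.
  rewrite a0 ?mulr0 // (negPf ne) orbF !negb_and.
  have [lS|] := boolP (l \in S); last by rewrite !inE => /negPf->; rewrite andbF.
  by rewrite first ?orbT // mcs lS dl.
have [|/x0 ->] := boolP (l \in d :: cs); last by rewrite mul0r.
by rewrite in_cons (negPf ne) /= => /first /slam ->; rewrite mulr0.
Qed.

(** Transposition reverses the order and exchanges [lam] and [mu]; it reduces the
    removal of a maximal element to that of a minimal one. *)
Lemma solves_tr R S lam mu nu a :
  solves (converse R) S mu^T lam^T (- nu^T) a^T -> solves R S lam mu nu a.
Proof.
case=> sa ea da; split.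
- move=> i j; have := sa j i; rewrite !mxE => h /h /and3P[-> -> /=].
  by rewrite /converse eq_sym.
- move=> i j iS jS; have := ea j i jS iS.
  rewrite -!trmx_mul -linearB /= mxE [in RHS]mxE [in RHS]mxE => /(congr1 -%R).
  by rewrite opprK => <-; rewrite !mxE opprB.
by move=> nu0 i iS; have := da _ i iS; rewrite mxE; apply; rewrite nu0 trmx0 oppr0.
Qed.

Lemma peelable_solves R S lam mu nu : strict_order R -> peelable R ->
  supported R lam -> supported R mu -> supported R nu ->
  covers_nonzero R S lam -> covers_nonzero R S mu ->
  exists a, solves R S lam mu nu a.
Proof.
move=> so pe slam smu snu; have [m] := ubnP #|S|.
elim: m S => // m IH S leS clam cmu.
have [->|/pe[d dS ext]] := eqVneq S set0.
  exists 0; split=> [i j|i j|_ i]; rewrite ?inE //.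
  by rewrite mxE eqxx.
have ext' : (forall i, i \in S -> ~~ R i d) \/ (forall i, i \in S -> ~~ R d i).
  by case: ext => [[]|[]]; [left|right].
have [||| a' sa'] := IH (S :\ d).
- by move: leS; rewrite (cardsD1 d S) dS.
- exact: covers_nonzero_remove.
- exact: covers_nonzero_remove.
case: ext => [ch|ch]; first exact: row_step sa'.
have tr_supp L : supported R L -> supported (converse R) L^T.
  by move=> sL i j ij; rewrite mxE sL.
have tr_cov L : covers_nonzero R S L -> covers_nonzero (converse R) S L^T.
  move=> cL i j iS jS ij nb; rewrite mxE cL //.
  apply: contra nb => /existsP[l /and3P[lS il lj]].
  by apply/existsP; exists l; apply/and3P.
have [|||||||a sa] := @row_step (converse R) S d mu^T lam^T (- nu^T) a'^T _ dS ch.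
- exact: strict_order_converse.
- exact: tr_supp.
- exact: tr_supp.
- by move=> i j ij; rewrite mxE tr_supp ?oppr0.
- exact: tr_cov.
- exact: tr_cov.
- apply: solves_tr; rewrite !trmxK linearN /= trmxK opprK.
  by rewrite (_ : converse (converse R) = R).
by exists a^T; apply: solves_tr; rewrite trmxK.
Qed.

End RowStep.

(** * Generators of the radical bimodule and their orbit *)

Lemma inX_strict_order n (s : 'S_n) : strict_order (inX s).
Proof.
split=> [i|j i l]; first by rewrite /inX ltnn.
exact: inX_trans.
Qed.

Section GeneratorsOfD.
Variables (k : fieldType) (n : nat) (s : 'S_n).
Local Notation A := (algA k s).
Local Notation D := (modD k s).

Lemma algA_supp (a : A) i j : ~~ inY s i j -> a i j = 0.
Proof. by have /suppYP := mxAP a; apply. Qed.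

Lemma modD_supp (d : D) : supported (inX s) d.
Proof. by have /suppXP := mxDP d. Qed.

Definition is_cover (p : 'I_n * 'I_n) : bool :=
  inX s p.1 p.2 && ~~ between (inX s) [set: 'I_n] p.1 p.2.

Lemma first_cover i l : inX s i l -> exists2 j, is_cover (i, j) & inY s j l.
Proof.
move=> il; pose P := [pred j | inX s i j && inY s j l].
have P0 : P l by rewrite /=;  rewrite il /inY eqxx orbT.
have [j /andP[ij jl] minj] := arg_minnP (fun j : 'I_n => j : nat) P0.
rewrite /= in ij jl minj.
exists j => //; rewrite /is_cover ij /=; apply/existsP => -[m /and3P[_ im mj]].
have := minj m; rewrite /= im (inXY (inXY_trans mj jl)) => /(_ isT).
by case/andP: mj => mj _; rewrite leqNgt mj.
Qed.

(** An entry of [a lam b] at a cover only sees the entry of [lam] there, so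
    generators are nonzero at covers.  Conversely, for a cover [(i, j)] below
    [(i, l)], a nonzero [lam i j] gives
    [beta i l = (lam i j)^-1 *: alpha i i * lam * alpha j l]. *)
Lemma Dgen_cover (lam : D) :
  Dgen lam <-> forall p, is_cover p -> lam p.1 p.2 != 0.
Proof.
split=> [gen [i l] /andP[/= il nb]|cov mu].
  have [m [a [b /(congr1 (fun d : D => d i l))]]] := gen (beta k s i l).
  rewrite mx_beta // mxE !eqxx mxD_sum summxE => E.
  apply: contraTneq (oner_neq0 k) => lam0.
  rewrite -[1]/(true%:R) E big1 ?eqxx // => t _.
  rewrite /= mxE big1 // => v _; rewrite mxE big_distrl big1 //= => u _.
  have [iu|/(algA_supp (a t)) ->] := boolP (inY s i u); last by rewrite !mul0r.
  have [vl|/(algA_supp (b t)) ->] := boolP (inY s v l); last by rewrite !mulr0.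
  have [uv|/modD_supp ->] := boolP (inX s u v); last by rewrite mulr0 mul0r.
  have nbw w : inX s i w && inX s w l = false.
    by apply: contraNF nb => iwl; apply/existsP; exists w; rewrite inE.
  case/orP: iu => [iu|/eqP iu].
    by have := nbw u; rewrite iu (inXY_trans uv vl).
  case/orP: vl => [vl|/eqP vl]; first by have := nbw v; rewrite iu uv vl.
  by rewrite -iu vl lam0 mulr0 mul0r.
pose nxt (p : 'I_n * 'I_n) := odflt p.1 [pick j | is_cover (p.1, j) && inY s j p.2].
have nxtP p : inX s p.1 p.2 -> is_cover (p.1, nxt p) && inY s (nxt p) p.2.
  move=> /first_cover[j cj jl]; rewrite /nxt; case: pickP => [//|/(_ j)].
  by rewrite cj jl.
pose I := {: 'I_n * 'I_n}; pose e (t : 'I_#|I|) : I := enum_val t.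
pose c (p : I) := mu p.1 p.2 / lam p.1 (nxt p).
exists #|I|,
  (fun t => (if inX s (e t).1 (e t).2 then c (e t) else 0)
            *: alpha k s (e t).1 (e t).1),
  (fun t => alpha k s (nxt (e t)) (e t).2).
rewrite [LHS]beta_span big_mkcond (reindex e) /=; last exact/onW_bij/enum_val_bij.
apply: eq_bigr => t _; move: (e t) => p {t}; have [Xp|_] := ifP; last first.
  by apply: val_inj; rewrite /= scale0r !mul0mx.
have /andP[cp Yp] := nxtP p Xp; have /andP[/= Xn _] := cp.
apply: val_inj.
transitivity (mu p.1 p.2 *: mxD (beta k s p.1 p.2)); first by [].
transitivity (c p *: mxA (alpha k s p.1 p.1) *m lam *m alpha k s (nxt p) p.2);
  last by [].
rewrite !mx_alpha ?mx_beta //; last by rewrite /inY eqxx orbT.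
apply/matrixP => u v.
rewrite -!scalemxAl !mxE (bigD1 (nxt p)) //= big1 ?addr0 => [|l ne]; last first.
  by rewrite [delta_mx _ _ l v]mxE (negPf ne) mulr0.
rewrite [(_ *m _) _ _]mxE (bigD1 p.1) //= big1 ?addr0 => [|l ne]; last first.
  by rewrite [delta_mx _ _ u l]mxE (negPf ne) andbF mul0r.
rewrite !mxE !eqxx andbT /c.
have := cov _ cp; rewrite /= => ne0.
case: (u == p.1); case: (v == p.2);
  rewrite /= ?mulr0 ?mul0r ?mulr0 ?mulr1 ?mul1r //.
by rewrite mulfVK.
Qed.


Definition diag_nonzero (g : A) : Prop := forall i, g i i != 0.

(** The inverse matrix stays in [algA]: row [i] of [g *m invmx g = 1] expresses the
    entries of row [i] of the inverse through those of later rows. *)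
Lemma unitA_of_diag (g : A) : diag_nonzero g -> exists u : unitA k s, uval u = g.
Proof.
move=> dg; have up (i j : 'I_n) : (j < i)%N -> g i j = 0.
  move=> ji; apply: algA_supp; apply: contraL ji => /orP[/andP[ij _]|/eqP->].
    by rewrite -leqNgt ltnW.
  by rewrite ltnn.
have gU : mxA g \in unitmx.
  rewrite unitmxE -det_tr det_trig.
    by rewrite unitfE; apply/prodf_neq0 => i _; rewrite mxE.
  by apply/is_trig_mxP => i j ij; rewrite mxE up.
pose h := invmx g; have gh : mxA g *m h = 1%:M by rewrite mulmxV.
have hY : h \in suppY s.
  apply/suppYP => i j.
  have [m] := ubnP (n - i); elim: m i => // m IH i lem nY.
  have := congr1 (fun M : 'M[k]_n => M i j) gh.
  rewrite !mxE (bigD1 i) //= big1 => [|l li].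
    move: (nY); rewrite negb_or => /andP[_ /negPf->] /eqP.
    by rewrite addr0 mulf_eq0 (negPf (dg i)) => /eqP.
  have [il|/algA_supp ->] := boolP (inY s i l); last by rewrite mul0r.
  rewrite IH ?mulr0 //.
    case/orP: il li => [/andP[il _] _|/eqP->]; last by rewrite eqxx.
    by have := ltn_ord l; lia.
  by apply: contra nY; apply: inY_trans.
have E1 : g * AlgA hY = 1 by apply: val_inj.
have E2 : AlgA hY * g = 1 by apply: val_inj; apply: mulVmx.
by exists (UnitA E1 E2).
Qed.

Lemma twisted_solve (lam mu nu : D) : smooth s -> Dgen lam -> Dgen mu ->
  exists a : A, lact a lam - Defs.ract mu a = nu /\ (nu = 0 -> diag_nonzero a).
Proof.
move=> sm /Dgen_cover clam /Dgen_cover cmu.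
have cov (d : D) : (forall p, is_cover p -> d p.1 p.2 != 0) ->
    covers_nonzero (inX s) [set: 'I_n] d.
  by move=> cd i j _ _ ij nb; apply: (cd (i, j)); rewrite /is_cover ij.
have [a [sa ea da]] := peelable_solves (inX_strict_order s)
  (smooth_peelable sm) (@modD_supp lam) (@modD_supp mu) (@modD_supp nu)
  (cov _ clam) (cov _ cmu).
have aY : a \in suppY s.
  by apply/suppYP => i j; apply: contraNeq => /sa /and3P[].
exists (AlgA aY); split.
  by apply: val_inj; apply/matrixP => i j; rewrite -ea.
by move=> nu0 i; apply: da => //; rewrite nu0.
Qed.

Lemma Smap_surj (lam : D) : smooth s -> Dgen lam ->
  forall mu : D, exists a : A, Smap lam a = mu.
Proof.
by move=> sm gl mu; have [a [ea _]] := twisted_solve mu sm gl gl; exists a.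
Qed.

Lemma Dgen_transitive (lam mu : D) : smooth s -> Dgen lam -> Dgen mu ->
  exists g : unitA k s, conjD g lam = mu.
Proof.
move=> sm gl gm; have [a [ea /(_ erefl) da]] := twisted_solve 0 sm gl gm.
have [g ga] := unitA_of_diag da; exists g.
rewrite /conjD ga; move/eqP: ea; rewrite subr_eq0 => /eqP->.
by rewrite -ga -ractM uvalV ract1.
Qed.

Lemma Dgen_conj (g : unitA k s) (lam : D) : Dgen lam -> Dgen (conjD g lam).
Proof.
move=> gen mu; have [m [a [b ->]]] := gen mu.
exists m, (fun t => a t * uinv g), (fun t => uval g * b t).
apply: eq_bigr => t _; rewrite /conjD.
by rewrite -lractA -lactM -mulrA uinvV mulr1 -ractM mulrA uinvV mul1r.
Qed.

Definition all_one : D :=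
  ModD (introT (suppXP s (\matrix_(i, j) (inX s i j)%:R : 'M[k]_n))
    (fun i j nX => etrans (mxE _ _ i j)
      (congr1 (fun b : bool => b%:R) (negPf nX)))).

Lemma all_oneE i j : all_one i j = (inX s i j)%:R.
Proof. by rewrite mxE. Qed.

Lemma Dgen_all_one : Dgen all_one.
Proof. by apply/Dgen_cover => p /andP[Xp _]; rewrite all_oneE Xp oner_neq0. Qed.

Lemma Dgen_acts : smooth s -> acts_transitively_on (@Dgen k n s).
Proof.
move=> sm; split; first exact: Dgen_conj.
  by exists all_one; apply: Dgen_all_one.
by move=> lam mu; apply: Dgen_transitive.
Qed.

Lemma Dgen_orbit : smooth s -> is_orbit (@Dgen k n s).
Proof.
move=> sm; exists all_one => mu; split=> [|[g <-]]; last first.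
  exact/Dgen_conj/Dgen_all_one.
exact/Dgen_transitive/Dgen_all_one.
Qed.

Local Notation XI := {p : 'I_n * 'I_n | inX s p.1 p.2}.

Lemma Dgen_zariski_open : zariski_open (@coordD k n s) (@Dgen k n s).
Proof.
pose q : {mpoly k[#|{: XI}|]} := \prod_(t | is_cover (val (enum_val t))) 'X_t.
exists (fun p => p = q) => lam.
have qE : q.@[fun t => coordD (enum_val t) lam] =
    \prod_(t | is_cover (val (@enum_val {: XI} predT t))) coordD (enum_val t) lam.
  by rewrite rmorph_prod; apply: eq_bigr => t _; rewrite /= mevalXU.
split=> [nG _ ->|/(_ _ erefl)].
  rewrite qE; apply/eqP/negPn/negP => /prodf_neq0 nz; apply: nG.
  apply/Dgen_cover => p cp; have Xp : inX s p.1 p.2 by case/andP: cp.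
  have := nz (enum_rank (exist _ p Xp : XI)); rewrite /coordD enum_rankK /=.
  exact.
rewrite qE => /eqP/prodf_eq0[t ct /eqP lt0] /Dgen_cover/(_ _ ct)/eqP; apply.
exact: lt0.
Qed.


Lemma conjD1 lam : exists g : unitA k s, conjD g lam = lam.
Proof.
by exists (UnitA (mul1r 1) (mul1r 1)); rewrite /conjD lact1 ract1.
Qed.

Lemma conjDV (g : unitA k s) lam :
  exists h : unitA k s, conjD h (conjD g lam) = lam.
Proof.
exists (UnitA (uinvV g) (uvalV g)).
by rewrite /conjD /= -lractA -lactM -ractM !uinvV lact1 ract1.
Qed.

Lemma conjDM (g h : unitA k s) lam :
  exists u : unitA k s, conjD u lam = conjD g (conjD h lam).
Proof.
have E1 : (uval g * uval h) * (uinv h * uinv g) = 1.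
  by rewrite mulrA -(mulrA (uval g)) uvalV mulr1 uvalV.
have E2 : (uinv h * uinv g) * (uval g * uval h) = 1.
  by rewrite mulrA -(mulrA (uinv h)) uinvV mulr1 uinvV.
by exists (UnitA E1 E2); rewrite /conjD /= lactM ractM lractA.
Qed.

End GeneratorsOfD.

Lemma meval_line (k : fieldType) m (p : {mpoly k[m]}) (v w : 'I_m -> k) :
  exists q : {poly k}, forall t, q.[t] = p.@[fun i => v i + t * w i].
Proof.
exists (\sum_(e <- msupp p)
          (p@_e)%:P * \prod_i ((v i)%:P + 'X * (w i)%:P) ^+ e i) => t.
rewrite mevalE horner_sum; apply: eq_bigr => e _.
rewrite hornerM hornerC horner_prod; congr (_ * _); apply: eq_bigr => i _.
by rewrite horner_exp hornerD hornerM hornerX !hornerC.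
Qed.

(** Two open orbits meet since the field is infinite: on the line through a point
    [lam0] of [O] in the direction of [all_one], both leaving [O] and leaving
    [Dgen] happen only at roots of nonzero polynomials in [t]. *)
Lemma open_orbit_unique (k : closedFieldType) n (s : 'S_n)
    (O : modD k s -> Prop) lam :
  smooth s -> open_orbit O -> (O lam <-> Dgen lam).
Proof.
move=> sm [[lam0 orb] [P opn]].
have O0 : O lam0 by apply/orb/conjD1.
have [p [Pp p0]] : exists p, P p /\ p.@[fun t => coordD (enum_val t) lam0] != 0.
  apply: NNPP => h; apply: (proj2 (opn lam0) _ O0) => p Pp.
  by apply/eqP/negPn/negP => p0; apply: h; exists p.
have [q qE] := meval_line p (fun t => coordD (enum_val t) lam0) (fun=> 1).
pose r : {poly k} := \prod_(c | is_cover s c) ((lam0 c.1 c.2)%:P + 'X).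
have : q * r != 0.
  rewrite mulf_neq0 //.
    apply: contraNneq p0 => q0; have := qE 0; rewrite q0 horner0 => /esym/eqP.
    by congr (_ == 0); apply: meval_eq => t; rewrite mul0r addr0.
  by apply/prodf_neq0 => c _; rewrite addrC -size_poly_gt0 size_XaddC.
case/closed_nonrootP => t; rewrite rootE hornerM mulf_eq0 negb_or => /andP[qt rt].
pose e := lam0 + t *: all_one k s.
have eE i j : e i j = lam0 i j + t * (inX s i j)%:R by rewrite !mxE.
have Oe : O e.
  apply: NNPP => /opn/(_ p Pp)/eqP; apply/negP; move: qt; rewrite qE.
  congr (_ != 0); apply: meval_eq => c; rewrite /coordD eE.
  by rewrite (valP (enum_val c)).
have ge : Dgen e.
  apply/Dgen_cover => c cc; move: rt; rewrite horner_prod => /prodf_neq0/(_ c cc).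
  by rewrite hornerD hornerC hornerX eE; case/andP: cc => -> _; rewrite mulr1.
have [h he] := proj1 (orb e) Oe.
split=> [/orb[g <-]|gl].
  by apply: Dgen_conj; have [h' <-] := conjDV h lam0; rewrite he; apply: Dgen_conj.
have [g <-] := Dgen_transitive sm ge gl; rewrite -he.
by have [u <-] := conjDM g h lam0; apply/orb; exists u.
Qed.

(** * Extensions and cocycles *)

Section Cocycles.
Variables (k : fieldType) (N : nat) (X Y : pimod k N).

(** After a splitting of the graded spaces, [tau] and [beta] are the off-diagonal
    blocks of the two structure maps of an extension of [X] by [Y]; the cocycle
    condition is the preprojective relation for the block triangular maps. *)
Definition cocycle (tau : forall v, 'M[k]_(pdim Y v.+1, pdim X v))
    (beta : forall v, 'M[k]_(pdim Y v, pdim X v.+1)) : Prop :=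
  forall v, LT Y v *m beta v + tau v *m LB X v =
    LB Y v.+1 *m tau v.+1 + beta v.+1 *m LT X v.+1.

Definition coboundary (tau : forall v, 'M[k]_(pdim Y v.+1, pdim X v))
    (beta : forall v, 'M[k]_(pdim Y v, pdim X v.+1)) : Prop :=
  exists f : forall v, 'M[k]_(pdim Y v, pdim X v), forall v,
    tau v = LT Y v *m f v - f v.+1 *m LT X v /\
    beta v = LB Y v *m f v.+1 - f v *m LB X v.

Lemma eq_cols m p (A B : 'M[k]_(m, p)) : (forall j, col j A = col j B) -> A = B.
Proof.
by move=> h; apply/matrixP => i j; have /colP/(_ i) := h j; rewrite !mxE.
Qed.

Lemma col_mul m p q (A : 'M[k]_(m, p)) (B : 'M[k]_(p, q)) j :
  col j (A *m B) = A *m col j B.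
Proof. by rewrite !colE mulmxA. Qed.

Lemma injective_row_full m p (A : 'M[k]_(m, p)) :
  (forall u : 'cV_p, A *m u = 0 -> u = 0) -> row_full A.
Proof.
move=> inj; rewrite -[row_full A]/(\rank A == p) -mxrank_tr -/(row_free A^T).
rewrite -kermx_eq0; apply/eqP/row_matrixP => i; rewrite row0.
apply: trmx_inj; rewrite trmx0; apply: inj.
by rewrite -{1}[A]trmxK -trmx_mul -row_mul mulmx_ker row0 trmx0.
Qed.

Lemma surjective_row_free m p (A : 'M[k]_(m, p)) :
  (forall w : 'cV_m, exists u, A *m u = w) -> row_free A.
Proof.
move=> sur; rewrite -[row_free A]/(\rank A == m) -mxrank_tr -/(row_full A^T).
rewrite -sub1mx; apply/row_subP => i.
have [u Au] := sur (row i 1%:M)^T.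
by apply/submxP; exists u^T; rewrite -trmx_mul Au trmxK.
Qed.

(** The splittings come from pseudo-inverses, so that they are given as functions
    of the vertex. *)
Lemma exact_splitting (m p q : nat -> nat) (i : forall v, 'M[k]_(p v, m v))
    (s : forall v, 'M[k]_(q v, p v)) :
  (forall v (u : 'cV_(m v)), i v *m u = 0 -> u = 0) ->
  (forall v (w : 'cV_(q v)), exists u, s v *m u = w) ->
  (forall v (u : 'cV_(p v)), s v *m u = 0 <-> exists w, u = i v *m w) ->
  exists (ret : forall v, 'M[k]_(m v, p v)) (sec : forall v, 'M[k]_(p v, q v)),
    forall v, [/\ s v *m i v = 0, ret v *m i v = 1%:M, s v *m sec v = 1%:M,
      ret v *m sec v = 0 & i v *m ret v + sec v *m s v = 1%:M].
Proof.
move=> injP surP ex.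
have pF v : s v *m pinvmx (s v) = 1%:M.
  by apply/mulmxVp/surjective_row_free/surP.
have iF v : pinvmx (i v) *m i v = 1%:M.
  by apply/mulVpmx/injective_row_full/injP.
pose sec v := pinvmx (s v).
pose ret v := pinvmx (i v) *m (1%:M - sec v *m s v).
have pi v : s v *m i v = 0.
  apply: eq_cols => j; rewrite col_mul col0; apply/ex.
  by exists (delta_mx j 0); rewrite -colE.
exists ret, sec => v; split=> //.
- by rewrite /ret -mulmxA mulmxBl mul1mx -(mulmxA (sec v)) pi mulmx0 subr0 iF.
- by rewrite /ret -mulmxA mulmxBl mul1mx -(mulmxA (sec v)) pF mulmx1 subrr mulmx0.
suff -> : i v *m ret v = 1%:M - sec v *m s v by rewrite subrK.
apply: eq_cols => j; rewrite !col_mul.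
have /ex[w ->] : s v *m col j (1%:M - sec v *m s v) = 0.
  by rewrite -col_mul mulmxBr mulmx1 mulmxA pF mul1mx subrr col0.
by rewrite (mulmxA (pinvmx _)) iF mul1mx.
Qed.

(** A coboundary [f] for the cocycle of an extension corrects the linear retraction
    [ret] into the module retraction [ret + f \o p], which splits it. *)
Lemma Ext1_zero_of_coboundary :
  (forall tau beta, cocycle tau beta -> coboundary tau beta) -> Ext1_zero X Y.
Proof.
move=> H [M i p injP surP ex].
have [ret [sec spl]] := exact_splitting injP surP ex.
have pi v : p v *m i v = 0 by have [] := spl v.
have ri v : ret v *m i v = 1%:M by have [] := spl v.
have pF v : p v *m sec v = 1%:M by have [] := spl v.
have dec v : i v *m ret v + sec v *m p v = 1%:M by have [] := spl v.
pose tau v := ret v.+1 *m LT M v *m sec v.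
pose beta v := ret v *m LB M v *m sec v.+1.
have tauE v : ret v.+1 *m LT M v - LT Y v *m ret v = tau v *m p v.
  rewrite /tau -mulmxA -[ret _ *m _ in LHS]mulmx1 -(dec v) mulmxDr addrC addrA.
  rewrite -[ret _ *m _ *m (i v *m _)]mulmxA (mulmxA (LT M v)) -hmapT.
  by rewrite !mulmxA ri mul1mx addNr add0r.
have betaE v : ret v *m LB M v - LB Y v *m ret v.+1 = beta v *m p v.+1.
  rewrite /beta -mulmxA -[ret _ *m _ in LHS]mulmx1 -(dec v.+1) mulmxDr addrC addrA.
  rewrite -[ret _ *m _ *m (i _ *m _)]mulmxA (mulmxA (LB M v)) -hmapB.
  by rewrite !mulmxA ri mul1mx addNr add0r.
have coc : cocycle tau beta.
  move=> v; have := congr1 (fun A => ret v.+1 *m A *m sec v.+1) (Lrel M v).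
  rewrite /= !mulmxA (canRL (subrK _) (tauE v)) (canRL (subrK _) (betaE v.+1)).
  have pB : tau v *m p v *m LB M v *m sec v.+1 = tau v *m LB X v.
    by rewrite -(mulmxA (tau v)) hmapB -!mulmxA pF mulmx1.
  have pT : beta v.+1 *m p v.+2 *m LT M v.+1 *m sec v.+1 = beta v.+1 *m LT X v.+1.
    by rewrite -(mulmxA (beta _)) hmapT -!mulmxA pF mulmx1.
  rewrite !mulmxDl pB pT -!(mulmxA _ (ret _)).
  rewrite -!(mulmxA (LT Y v)) -!(mulmxA (LB Y _)).
  by move=> E; rewrite [LHS]addrC [RHS]addrC [LHS]E.
have [f fE] := H _ _ coc.
pose rho v := ret v + f v *m p v.
have rhoT v : rho v.+1 *m LT M v = LT Y v *m rho v.
  apply/eqP; rewrite -subr_eq0 /rho mulmxDl mulmxDr opprD addrACA tauE.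
  by rewrite (proj1 (fE v)) -(mulmxA (f _)) hmapT mulmxBl !mulmxA addrA subrK subrr.
have rhoB v : rho v *m LB M v = LB Y v *m rho v.+1.
  apply/eqP; rewrite -subr_eq0 /rho mulmxDl mulmxDr opprD addrACA betaE.
  by rewrite (proj2 (fE v)) -(mulmxA (f _)) hmapB mulmxBl !mulmxA addrA subrK subrr.
have phiT v : col_mx (rho v.+1) (p v.+1) *m LT M v =
    LT (split_mod X Y) v *m col_mx (rho v) (p v).
  by rewrite mul_col_mx mul_block_col !mul0mx addr0 add0r rhoT hmapT.
have phiB v : col_mx (rho v) (p v) *m LB M v =
    LB (split_mod X Y) v *m col_mx (rho v.+1) (p v.+1).
  by rewrite mul_col_mx mul_block_col !mul0mx addr0 add0r rhoB hmapB.
exists (@PiHom k N M (split_mod X Y) (fun v => col_mx (rho v) (p v))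
  phiT phiB).
split=> v /=.
  by rewrite mul_col_mx pi mulmxDl ri -mulmxA pi mulmx0 addr0.
by rewrite mul_row_col mul0mx mul1mx add0r.
Qed.

End Cocycles.

Lemma zmod_exchange (V : zmodType) (a b c d e g : V) :
  a + (b - c) = d - e + g -> a - (d - b) = g - (e - c).
Proof.
move/(canRL (addrK _)) => ->; rewrite !opprB !addrA subrK addrC !addrA addNr add0r.
by rewrite [- e + g]addrC addrAC.
Qed.

(** Coboundaries are cocycles, so [tau] may be killed first and [beta] treated
    afterwards. *)
Lemma coboundary_of_two_steps (k : fieldType) N (X Y : pimod k N) :
  (forall (tau : forall v, 'M[k]_(pdim Y v.+1, pdim X v))
          (beta : forall v, 'M[k]_(pdim Y v, pdim X v.+1)), cocycle tau beta ->
     exists f : forall v, 'M[k]_(pdim Y v, pdim X v),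
       forall v, tau v = LT Y v *m f v - f v.+1 *m LT X v) ->
  (forall beta : forall v, 'M[k]_(pdim Y v, pdim X v.+1),
     cocycle (fun v => 0) beta -> coboundary (fun v => 0) beta) ->
  forall tau beta, @cocycle k N X Y tau beta -> coboundary tau beta.
Proof.
move=> H1 H2 tau beta coc; have [f fE] := H1 _ _ coc.
pose beta' v := beta v - (LB Y v *m f v.+1 - f v *m LB X v).
have [|g gE] := H2 beta'.
  move=> v; rewrite mul0mx mulmx0 addr0 add0r /beta'.
  rewrite (mulmxBr _ (beta v)) (mulmxBl (beta _)) mulmxBr mulmxBl.
  apply: zmod_exchange; have := coc v.
  rewrite !fE mulmxBl mulmxBr !mulmxA (Lrel Y) -(mulmxA (f v.+1)) (Lrel X).
  by rewrite !mulmxA.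
exists (fun v => f v + g v) => v; have [gT gB] := gE v.
split; first by rewrite mulmxDr mulmxDl opprD addrACA -gT addr0 fE.
by rewrite mulmxDr mulmxDl opprD addrACA -gB /beta' addrC subrK.
Qed.

(** * Cocycles as matrices indexed by the summands *)

Section Masks.
Variables (k : fieldType) (n : nat) (s : 'S_n).
Local Notation A := (algA k s).
Local Notation D := (modD k s).

Definition covers_vertex (v : nat) (i : 'I_n) : bool :=
  (i < v <= 2 * n - (s i).+1)%N.
Local Notation S := covers_vertex.

(** The projection of the space with basis the summands of [Mrep] onto the span of
    those that are nonzero at the vertex [v].  Through it, all maps between the
    spaces at the vertices become n x n matrices. *)
Definition vmask (v : nat) : 'M[k]_n := diag_mx (\row_i (S v i)%:R).
Local Notation E := vmask.

Lemma maskl v (m : 'M[k]_n) i j : (E v *m m) i j = (S v i)%:R * m i j.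
Proof. by rewrite mul_diag_mx !mxE. Qed.

Lemma maskr v (m : 'M[k]_n) i j : (m *m E v) i j = m i j * (S v j)%:R.
Proof. by rewrite mul_mx_diag !mxE. Qed.

Lemma mask_idem v : E v *m E v = E v.
Proof.
apply/matrixP => i j; rewrite maskl !mxE.
by case: (S v i); rewrite ?mul1r ?mul0r ?mul0rn.
Qed.

Lemma mask0 : E 0 = 0.
Proof. by apply/matrixP => i j; rewrite !mxE /S ltn0 mul0rn. Qed.

Lemma mask_2n : E (2 * n) = 0.
Proof.
apply/matrixP => i j; rewrite !mxE /S.
suff /negPf-> : ~~ (i < 2 * n <= 2 * n - (s i).+1)%N by rewrite mul0rn.
by have := ltn_ord i; lia.
Qed.

Lemma ltn_perm (i : 'I_n) : (s i < n)%N. Proof. exact: ltn_ord. Qed.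

Lemma inX_bounds i j : inX s i j -> (i < j)%N /\ (s j < s i)%N.
Proof. by case/andP. Qed.

Lemma inY_bounds i j : inY s i j -> (i <= j)%N /\ (s j <= s i)%N.
Proof. by case/orP => [/inX_bounds[]|/eqP->]; lia. Qed.

(** Let [i <= j] in the inversion order.  The [i]-th summand starts and ends no
    later than the [j]-th one, so if it contains [v.+1] while the [j]-th contains
    [v], both contain [v] and [v.+1].  Arguments of this kind make the masks in
    the middle of the products below redundant. *)
Lemma mask_alg1 v (a : A) : E v.+1 *m a *m E v.+1 *m E v = E v.+1 *m a *m E v.
Proof.
apply/matrixP => i j; rewrite !maskr maskl.
have [/inY_bounds Y|/algA_supp->] := boolP (inY s i j); last by rewrite mulr0 !mul0r.
case Si: (S v.+1 i); case Sj: (S v j); rewrite ?mulr0 ?mul0r //.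
by rewrite (_ : S v.+1 j) ?mulr1 //; move: Si Sj; rewrite /S; lia.
Qed.

Lemma mask_alg2 v (a : A) : E v.+1 *m E v *m a *m E v = E v.+1 *m a *m E v.
Proof.
apply/matrixP => i j; rewrite !maskr -mulmxA !maskl.
have [/inY_bounds Y|/algA_supp->] := boolP (inY s i j); last by rewrite !mulr0 !mul0r.
case Si: (S v.+1 i); case Sj: (S v j); rewrite ?mulr0 ?mul0r //.
by rewrite (_ : S v i) ?mul1r //; move: Si Sj; rewrite /S; lia.
Qed.

Lemma mask_mod_alg v (d : D) (a : A) :
  E v *m d *m E v.+1 *m a *m E v.+1 = E v *m d *m a *m E v.+1.
Proof.
apply/matrixP => i j; rewrite !maskr.
case Sj: (S v.+1 j); last by rewrite !mulr0.
rewrite !mulr1 !mxE; apply: eq_bigr => l _; rewrite maskr maskl.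
case Si: (S v i); last by rewrite !mul0r.
have [/inX_bounds X|/modD_supp->] := boolP (inX s i l); last by rewrite mulr0 !mul0r.
have [/inY_bounds Y|/algA_supp->] := boolP (inY s l j); last by rewrite !mulr0.
by rewrite (_ : S v.+1 l) ?mulr1 //; move: Si Sj; rewrite /S; lia.
Qed.

Lemma mask_alg_mod v (a : A) (d : D) :
  E v *m a *m E v *m d *m E v.+1 = E v *m a *m d *m E v.+1.
Proof.
apply/matrixP => i j; rewrite !maskr.
case Sj: (S v.+1 j); last by rewrite !mulr0.
rewrite !mulr1 !mxE; apply: eq_bigr => l _; rewrite maskr maskl.
case Si: (S v i); last by rewrite !mul0r.
have [/inY_bounds X|/algA_supp->] := boolP (inY s i l); last by rewrite mulr0 !mul0r.
have [/inX_bounds Y|/modD_supp->] := boolP (inX s l j); last by rewrite !mulr0.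
by rewrite (_ : S v l) ?mulr1 //; move: Si Sj; rewrite /S; lia.
Qed.

Lemma mask_mod_rel v (d : D) :
  E v.+1 *m E v *m d *m E v.+1 = E v.+1 *m d *m E v.+2 *m E v.+1.
Proof.
apply/matrixP => i j; rewrite !maskr -mulmxA !maskl.
case Si: (S v.+1 i); case Sj: (S v.+1 j); rewrite ?mulr0 ?mul0r // !mul1r !mulr1.
have [/inX_bounds Y|/modD_supp->] := boolP (inX s i j); last by rewrite mulr0 mul0r.
have -> : S v i by move: Si Sj; rewrite /S; lia.
have -> : S v.+2 j by move: Si Sj; rewrite /S; lia.
by rewrite mulr1 mul1r.
Qed.

Variable lam : D.
Hypothesis surj : forall mu : D, exists a : A, Smap lam a = mu.

Section KillTau.
Variables (tau beta : nat -> 'M[k]_n).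
Hypothesis tauE : forall v, tau v = E v.+1 *m tau v *m E v.
Hypothesis betaE : forall v, beta v = E v *m beta v *m E v.+1.
Hypothesis coc : forall v, E v.+1 *m beta v + tau v *m lam *m E v.+1 =
  E v.+1 *m lam *m tau v.+1 + beta v.+1 *m E v.+1.

Definition total_tau : 'M[k]_n := \sum_(v < 2 * n) tau v.

Lemma trace_masked v w (A B m : 'M[k]_n) : m = E w *m m *m E v ->
  E v *m A *m E w = E v *m B *m E w -> \tr (A *m m) = \tr (B *m m).
Proof.
move=> mE AB; rewrite mE.
have tr_mask C : \tr (C *m (E w *m m *m E v)) = \tr (E v *m C *m E w *m m).
  by rewrite mulmxA mxtrace_mulC !mulmxA.
by rewrite !tr_mask AB.
Qed.

(** Multiplication by [a], which stands for an endomorphism of [Mrep], and the trace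
    kill the contribution of the maps of [Mrep] up to a telescoping term. *)
Lemma cocycle_trace v (a : A) :
  \tr (a *m beta v) + \tr (lam *m a *m tau v) =
  \tr (a *m lam *m tau v.+1) + \tr (a *m beta v.+1).
Proof.
have := congr1 (fun M => \tr (a *m M)) (coc v); rewrite /= !mulmxDr !mxtraceD.
have -> : \tr (a *m (E v.+1 *m beta v)) = \tr (a *m beta v).
  by rewrite mulmxA; apply: (trace_masked (betaE v)); rewrite !mulmxA mask_alg1.
have -> : \tr (a *m (tau v *m lam *m E v.+1)) = \tr (lam *m a *m tau v).
  rewrite -[tau v *m _ *m _]mulmxA mulmxA mxtrace_mulC mulmxA.
  by apply: (trace_masked (tauE v)); rewrite !mulmxA mask_mod_alg.
have -> : \tr (a *m (E v.+1 *m lam *m tau v.+1)) = \tr (a *m lam *m tau v.+1).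
  rewrite !mulmxA; apply: (trace_masked (tauE v.+1)).
  by rewrite !mulmxA mask_alg_mod.
have -> // : \tr (a *m (beta v.+1 *m E v.+1)) = \tr (a *m beta v.+1).
rewrite mulmxA mxtrace_mulC mulmxA.
by apply: (trace_masked (betaE v.+1)); rewrite !mulmxA mask_alg2.
Qed.

Lemma tau_eq0 v i j : ~~ (S v.+1 i && S v j) -> tau v i j = 0.
Proof.
by rewrite tauE maskr maskl; case: (S v.+1 i); case: (S v j); rewrite ?mulr0 ?mul0r.
Qed.

(** Summation over all vertices: [Mrep] vanishes at [0] and [2 * n], so no boundary
    terms remain. *)
Lemma Smap_total_tau (a : A) : \tr (Smap lam a *m total_tau) = 0.
Proof.
have -> : \tr (Smap lam a *m total_tau) =
    \sum_(v < 2 * n) (\tr (a *m lam *m tau v) - \tr (lam *m a *m tau v)).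
  rewrite -[mxD _]/(a *m lam - lam *m a) /total_tau mulmx_sumr raddf_sum /=.
  by apply: eq_bigr => v _; rewrite mulmxBl raddfB.
have b0 : beta 0 = 0 by rewrite betaE mask0 !mul0mx.
have b2 : beta (2 * n) = 0 by rewrite betaE mask_2n !mul0mx.
have t0 : tau 0 = 0 by rewrite tauE mask0 !mulmx0.
have t2 : tau (2 * n) = 0 by rewrite tauE mask_2n !mulmx0.
have tele (F : nat -> k) m : \sum_(v < m) (F v.+1 - F v) = F m - F 0%N.
  by rewrite -(big_mkord xpredT (fun v => F v.+1 - F v)) telescope_sumr.
have E1 : \sum_(v < 2 * n) (\tr (a *m lam *m tau v) - \tr (lam *m a *m tau v)) =
  - \sum_(v < 2 * n) (\tr (a *m lam *m tau v.+1) - \tr (a *m lam *m tau v))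
  - \sum_(v < 2 * n) (\tr (a *m beta v.+1) - \tr (a *m beta v)).
  rewrite -opprD -big_split -sumrN; apply: eq_bigr => v _ /=.
  by have := cocycle_trace v a => /(canRL (addKr _)) ->; ring.
rewrite E1 (tele (fun v => \tr (a *m lam *m tau v))).
rewrite (tele (fun v => \tr (a *m beta v))) b0 b2 t0 t2 !mulmx0.
by rewrite !subrr oppr0 addr0.
Qed.

(** The entries of [total_tau] at reversed inversions are the coordinates of the
    class of [tau] in the self-extensions of [Mrep]; these are dual to [modD],
    which consists of the commutators with [lam]. *)
Lemma total_tau_eq0 i j : inX s j i -> total_tau i j = 0.
Proof.
move=> Xji; have [a ea] := surj (Defs.beta k s j i).
have := Smap_total_tau a; rewrite ea mx_beta // => <-.
rewrite /mxtrace (bigD1 j) //= big1 => [|l ne].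
  rewrite addr0 mxE (bigD1 i) //= mxE !eqxx mul1r big1 ?addr0 // => l ne.
  by rewrite mxE (negPf ne) andbF mul0r.
by rewrite mxE big1 // => m _; rewrite mxE (negPf ne) mul0r.
Qed.

(** For fixed [i, j], the equation [tau v i j = f v i j - f v.+1 i j] lives on a
    path of vertices.  Its solution must vanish at the left end if [j < i] and at
    the right end if [s i < s j].  Partial sums of [tau] starting from either end
    vanish there; if both conditions are present, then [inX s j i], and the sums
    vanish at the other end as well because the total sum is zero. *)
Lemma tau_trivial : exists f : nat -> 'M[k]_n,
  forall v, tau v = E v.+1 *m (E v *m f v - f v.+1 *m E v.+1) *m E v.
Proof.
pose F v : 'M[k]_n := \matrix_(i, j)
  if (i <= j)%N then \sum_(v <= u < 2 * n) tau u i j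
  else - \sum_(0 <= u < v) tau u i j.
have tau_big v : (2 * n <= v)%N -> tau v = 0.
  move=> lev; apply/matrixP => i j; rewrite tau_eq0 ?mxE // /S.
  by have := ltn_ord i; lia.
have FE v i j : tau v i j = F v i j - F v.+1 i j.
  rewrite !mxE; case: ifP => _; last by rewrite big_nat_recr //= opprK addKr.
  have [lev|ltv] := leqP (2 * n) v.
    by rewrite tau_big // !big_geq ?mxE ?subrr // ltnW.
  by rewrite big_ltn // addrK.
exists F => v; apply/matrixP => i j; rewrite maskr maskl.
have [/andP[Si Sj]|nS] := boolP (S v.+1 i && S v j); last first.
  rewrite tau_eq0 //; move: nS.
  by case: (S v.+1 i); case: (S v j); rewrite ?mulr0 ?mul0r.
rewrite Si Sj mul1r mulr1 FE [RHS]mxE [X in _ = _ + X]mxE maskl maskr; congr (_ - _).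
  case Svi: (S v i); first by rewrite mul1r.
  rewrite mul0r mxE ifF; last by move: Si Sj Svi; rewrite /S; lia.
  rewrite big_nat big1 ?oppr0 // => u /andP[_ uv].
  by rewrite tau_eq0 //; move: Si Svi; rewrite /S; lia.
case Svj: (S v.+1 j); first by rewrite mulr1.
rewrite mulr0 mxE; case: ifPn => [le_ij|lt_ji].
  rewrite big_nat big1 // => u /andP[uv _].
  by rewrite tau_eq0 //; move: Sj Svj; rewrite /S; lia.
have Xji : inX s j i.
  rewrite /inX; move: lt_ji Si Sj Svj; rewrite /S.
  by have := ltn_perm i; have := ltn_perm j; lia.
have := total_tau_eq0 Xji; rewrite /total_tau summxE => tot.
have lev : (v.+1 <= 2 * n)%N by move: Sj; rewrite /S; lia.
rewrite -(big_mkord xpredT (fun u => tau u i j)) (big_cat_nat (n := v.+1)) //= in tot.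
rewrite [X in _ + X]big_nat [X in _ + X]big1 ?addr0 in tot.
  by rewrite tot oppr0.
move=> u /andP[uv _].
by rewrite tau_eq0 //; move: Sj Svj; rewrite /S; lia.
Qed.

End KillTau.

Lemma mask_comm_alg v (a : A) : E v.+1 *m (E v *m a - a *m E v.+1) *m E v = 0.
Proof.
by rewrite mulmxBr mulmxBl !mulmxA mask_alg1 mask_alg2 subrr.
Qed.

(** The relation makes the entries of [beta v] independent of [v], hence equal to
    those at [v = n], a vertex which belongs to all summands.  At a pair that is
    not an inversion, moving [v] to an end of its range gives 0.  So the common
    value lies in [modD] and is a commutator with [lam]. *)
Lemma beta_trivial (beta : nat -> 'M[k]_n) :
  (forall v, beta v = E v *m beta v *m E v.+1) ->
  (forall v, E v.+1 *m beta v = beta v.+1 *m E v.+1) ->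
  exists a : A, forall v,
    beta v = E v *m (lam *m E v.+1 *m a - a *m E v *m lam) *m E v.+1.
Proof.
move=> betaE coc.
have beta0 v i j : ~~ (S v i && S v.+1 j) -> beta v i j = 0.
  by rewrite betaE maskr maskl; case: (S v i); case: (S v.+1 j); rewrite ?mulr0 ?mul0r.
have step v i j : S v.+1 i -> S v.+1 j -> beta v i j = beta v.+1 i j.
  move=> Si Sj; have /matrixP/(_ i j) := coc v; rewrite maskl maskr.
  by rewrite Si Sj mul1r mulr1.
have up i j v : (v <= n)%N -> (forall u, (v < u <= n)%N -> S u i && S u j) ->
    beta v i j = beta n i j.
  have [m] := ubnP (n - v); elim: m v => // m IH v lem lev Su.
  move: lev; rewrite leq_eqVlt => /orP[/eqP-> //|ltv].
  have /andP[Si Sj] : S v.+1 i && S v.+1 j by apply: Su; rewrite ltnSn ltv.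
  by rewrite step // IH // ?lem => [|u uv]; [lia|apply: Su; lia].
have down i j v : (n <= v)%N -> (forall u, (n < u <= v)%N -> S u i && S u j) ->
    beta v i j = beta n i j.
  elim: v => [|v IH] lev Su; first by have := leq_trans (ltn_ord i) lev.
  have [-> //|ne] := eqVneq v.+1 n; have ltv : (n < v.+1)%N by lia.
  have /andP[Si Sj] : S v.+1 i && S v.+1 j by apply: Su; rewrite ltv leqnn.
  by rewrite -step // IH // => u uv; apply: Su; lia.
have muX : beta n \in suppX s.
  apply/suppXP => i j nX.
  have := ltn_perm i; have := ltn_perm j.
  have := ltn_ord i; have := ltn_ord j => ltj lti ltsj ltsi.
  have [le_ji|lt_ij] := leqP j i.
    rewrite -(up i j i) ?beta0 /S ?ltnn //; first exact: ltnW.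
    by move=> u; lia.
  rewrite -(down i j (2 * n - (s j).+1)%N) ?beta0 /S //; try lia.
  by move=> u; move: nX; rewrite /inX lt_ij /=; lia.
have [a ea] := surj (- ModD muX); exists a => v.
have -> : E v *m (lam *m E v.+1 *m a - a *m E v *m lam) *m E v.+1 =
    E v *m beta n *m E v.+1.
  rewrite mulmxBr mulmxBl !mulmxA mask_mod_alg mask_alg_mod.
  have : beta n = - (a *m lam - lam *m a).
    by apply: oppr_inj; rewrite opprK -[RHS]/(mxD (Smap lam a)) ea.
  by move=> ->; rewrite opprB mulmxBr mulmxBl !mulmxA.
apply/matrixP => i j; rewrite maskr maskl.
have [/andP[Si Sj]|nS] := boolP (S v i && S v.+1 j); last first.
  rewrite beta0 //; move: nS.
  by case: (S v i); case: (S v.+1 j); rewrite ?mulr0 ?mul0r.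
rewrite Si Sj mul1r mulr1.
have := ltn_perm i; have := ltn_perm j.
have := ltn_ord i; have := ltn_ord j => ltj lti ltsj ltsi.
have [lev|ltv] := leqP v n.
  by apply: up => // u; move: Si Sj; rewrite /S; lia.
by apply: down; [exact: ltnW|move=> u; move: Si Sj; rewrite /S; lia].
Qed.

End Masks.

(** * The rigid module attached to a generator *)

Section Rigidity.
Variables (k : fieldType) (n : nat) (s : 'S_n).
Local Notation A := (algA k s).
Local Notation D := (modD k s).
Local Notation E := (vmask k s).
Local Notation d := (qdim (Mrep k s)).

Definition incl (v : nat) : 'M[k]_(d v, n) :=
  \mxcol_(i < n)
    \matrix_(r < nat_of_bool (covers_vertex s v i), c < n) (c == i)%:R.
Local Notation P := incl.

Lemma incl_block (i j : 'I_n) a b :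
  (\matrix_(r < a, c < n) (c == i)%:R : 'M[k]_(a, n)) *m
    (\matrix_(r < b, c < n) (c == j)%:R : 'M[k]_(b, n))^T = const_mx (i == j)%:R.
Proof.
apply/matrixP => r c; rewrite !mxE (bigD1 i) //= !mxE eqxx mul1r big1 ?addr0 // => l ne.
by rewrite !mxE (negPf ne) mul0r.
Qed.

Lemma incl_trK v : P v *m (P v)^T = 1%:M.
Proof.
rewrite /incl tr_mxcol mul_mxcol_mxrow; apply/matrixP => r c.
rewrite mxE incl_block !mxE; congr (nat_of_bool _)%:R.
transitivity ((tagnat.sig1 r == tagnat.sig1 c) &&
    (tagnat.sig2 r == tagnat.sig2 c :> nat)); last first.
  by rewrite -tagnat.eq_Rank !tagnat.sig2K.
case: eqP => //= rc.
have z (b : bool) (x : 'I_b) : x = 0%N :> nat by case: b x => -[[|m]].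
by rewrite !z.
Qed.

Lemma incl_mask v : (P v)^T *m P v = E v.
Proof.
rewrite /incl tr_mxcol mul_mxrow_mxcol; apply/matrixP => i j.
rewrite summxE (bigD1 i) //= big1 => [|l ne].
  rewrite addr0 mxE; under eq_bigr do rewrite !mxE eqxx mul1r.
  by rewrite sumr_const card_ord !mxE eq_sym -!mulrnA mulnC.
by rewrite mxE big1 // => r _; rewrite !mxE eq_sym (negPf ne) mul0r.
Qed.

Lemma Mrep_qmap v : qmap (Mrep k s) v = P v.+1 *m (P v)^T.
Proof.
rewrite /incl tr_mxcol mul_mxcol_mxrow /=; apply: eq_mxblock => i j.
rewrite incl_block; case: eqP => [<-|_]; first by rewrite conform_mx_id.
by apply/matrixP => r c; rewrite !mxE.
Qed.

Lemma incl_maskl v : P v *m E v = P v.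
Proof. by rewrite -incl_mask mulmxA incl_trK mul1mx. Qed.

Lemma incl_maskr v : E v *m (P v)^T = (P v)^T.
Proof. by rewrite -incl_mask -mulmxA incl_trK mulmx1. Qed.

Variable lam : D.

(** The module structure on [Mrep] that corresponds to [lam] under the duality
    between [modD] and the self-extensions of [Mrep]: the [(i, j)] entry of [lam]
    is the scalar of the map [B] from the [j]-th summand to the [i]-th. *)
Definition ptT v : 'M[k]_(d v.+1, d v) := P v.+1 *m (P v)^T.
Definition ptB v : 'M[k]_(d v, d v.+1) := P v *m lam *m (P v.+1)^T.

Lemma pt_rel v : ptT v *m ptB v = ptB v.+1 *m ptT v.+1.
Proof.
rewrite /ptT /ptB !mulmxA -(mulmxA _ _ (P v)) -(mulmxA _ _ (P v.+2)) !incl_mask.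
have := congr1 (fun M => P v.+1 *m M *m (P v.+1)^T) (mask_mod_rel v lam).
by rewrite /= !mulmxA incl_maskl -!mulmxA incl_maskr !mulmxA.
Qed.

Definition pt : Lambda k d := LambdaPt pt_rel.

Lemma pt_Csigma : Csigma pt.
Proof.
move=> Z _; apply; exists (fun v => 1%:M), (fun v => 1%:M).
split=> v; [exact: mul1mx|exact: mul1mx|].
by rewrite mul1mx mulmx1 Mrep_qmap.
Qed.

Hypothesis surj : forall mu : D, exists a : A, Smap lam a = mu.

Local Notation X := (PiMod (Mrep_supp k s) pt).

(** The n x n matrix of a map between the spaces at [u] and [w]; it turns the
    cocycles of the module into those of matrices with masks. *)
Definition hat u w (m : 'M[k]_(d w, d u)) : 'M[k]_n := (P w)^T *m m *m P u.

Lemma hat_masked u w m : @hat u w m = E w *m hat m *m E u.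
Proof. by rewrite /hat !mulmxA incl_maskr -!mulmxA incl_maskl. Qed.

Lemma hatK u w m : P w *m @hat u w m *m (P u)^T = m.
Proof. by rewrite /hat !mulmxA incl_trK mul1mx -mulmxA incl_trK mulmx1. Qed.

Lemma hat_inj u w : injective (@hat u w).
Proof. by move=> m m' h; rewrite -(hatK m) h hatK. Qed.

Lemma hat0 u w : @hat u w 0 = 0.
Proof. by rewrite /hat mulmx0 mul0mx. Qed.

Lemma hatB u w m m' : @hat u w (m - m') = hat m - hat m'.
Proof. by rewrite /hat mulmxBr mulmxBl. Qed.

Lemma hatD u w m m' : @hat u w (m + m') = hat m + hat m'.
Proof. by rewrite /hat mulmxDr mulmxDl. Qed.

Lemma hatM u v w (m : 'M_(d w, d v)) (m' : 'M_(d v, d u)) :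
  hat (m *m m') = hat m *m hat m'.
Proof. by rewrite /hat !mulmxA -(mulmxA _ (P v)) incl_trK mulmx1. Qed.

Lemma hat_incl u w (f : 'M[k]_n) : hat (P w *m f *m (P u)^T) = E w *m f *m E u.
Proof. by rewrite /hat !mulmxA incl_mask -!mulmxA incl_mask. Qed.

Lemma hat_ptT v : hat (ptT v) = E v.+1 *m E v.
Proof. by have := hat_incl v v.+1 1%:M; rewrite !mulmx1. Qed.

Lemma hat_ptB v : hat (ptB v) = E v *m lam *m E v.+1.
Proof. exact: hat_incl. Qed.

Lemma mask_idemr v m (x : 'M[k]_(m, n)) : x *m E v *m E v = x *m E v.
Proof. by rewrite -mulmxA mask_idem. Qed.

Lemma hat_maskl u w m : E w *m @hat u w m = hat m.
Proof. by rewrite /hat !mulmxA incl_maskr. Qed.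

Lemma hat_maskr u w m : @hat u w m *m E u = hat m.
Proof. by rewrite /hat -mulmxA incl_maskl. Qed.

Lemma pt_rigid : Ext1_zero X X.
Proof.
apply: Ext1_zero_of_coboundary.
apply: coboundary_of_two_steps => [tau beta coc|beta coc].
  have [|||f fE] := @tau_trivial k n s lam surj
    (fun v => hat (tau v)) (fun v => hat (beta v)).
  - by move=> v; apply: hat_masked.
  - by move=> v; apply: hat_masked.
  - move=> v; have := congr1 (@hat _ _) (coc v).
    rewrite !hatD !hatM hat_ptT !hat_ptB hat_ptT -!(mulmxA _ _ (hat _)) !hat_maskl.
    by rewrite !mulmxA !hat_maskr.
  exists (fun v => P v *m f v *m (P v)^T) => v; apply: hat_inj.
  rewrite hatB !hatM hat_ptT !hat_incl [LHS]fE.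
  by rewrite mulmxBr mulmxBl !mulmxA !mask_idemr.
have [||a aE] := @beta_trivial k n s lam surj (fun v => hat (beta v)).
- by move=> v; apply: hat_masked.
- move=> v; have := congr1 (@hat _ _) (coc v).
  rewrite mul0mx mulmx0 addr0 add0r !hatM !hat_ptT.
  rewrite -!(mulmxA _ _ (hat _)) !hat_maskl.
  by rewrite !mulmxA !hat_maskr.
exists (fun v => P v *m a *m (P v)^T) => v; split; apply: hat_inj.
  rewrite hat0 hatB !hatM hat_ptT !hat_incl -[LHS](mask_comm_alg v a).
  by rewrite mulmxBr mulmxBl !mulmxA !mask_idemr.
rewrite hatB !hatM hat_ptB !hat_incl [LHS]aE.
by rewrite mulmxBr mulmxBl !mulmxA !mask_idemr.
Qed.
End Rigidity.

Theorem proposition5p9 (k : closedFieldType) (n : nat) (s : 'S_n) :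
  smooth s ->
  [/\ acts_transitively_on (@Dgen k n s),
      open_orbit (@Dgen k n s) /\
      (forall O : modD k s -> Prop, open_orbit O ->
         forall lam, O lam <-> Dgen lam),
      forall lam : modD k s, Dgen lam ->
        forall mu : modD k s, exists a : algA k s, Smap lam a = mu &
      rigid k s].
Proof.
move=> sm; split.
- exact: Dgen_acts.
- split; first by split; [exact: Dgen_orbit|exact: Dgen_zariski_open].
  by move=> O oO lam; apply: open_orbit_unique.
- by move=> lam gl; apply: Smap_surj.
exists (pt (all_one k s)); split; first exact: pt_Csigma.
exact/pt_rigid/(Smap_surj sm)/Dgen_all_one.
Qed.
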